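(* Let $G$ be a group, let $S$ be a finite primitive right $G$-set, let $F$ be an arbitrary field, and let $v \in F[S]$. Write $t = |\mathrm{supp}(v)|$, $d = \dim_F(\langle v\rangle)$ and $n = |S|$. Suppose that $1 < t < n-1$ and that $(t+1)d = 2n$. Let $\Omega = \{\mathrm{supp}(v)g \mid g \in G\}$ be the set of $G$-translates of $\mathrm{supp}(v)$. Then: (1) $t = d$ and the action of $G$ on $\Omega$ is doubly transitive; (2) every point of $S$ lies in exactly two members of $\Omega$, and every two distinct members of $\Omega$ intersect in a single point; (3) the field $F$ has characteristic $2$, and $v$ is a scalar multiple of the sum of the points in $\mathrm{supp}(v)$.
   Context: For a field $F$ and a right $G$-set $S$, $F[S]$ denotes the permutation module: the $F$-vector space of (finite) formal $F$-linear combinations of elements of $S$, with the right action of $G$ on $S$ extended linearly to $F[S]$. For $v\in F[S]$, $\mathrm{supp}(v)$ is the set of points of $S$ that occur with nonzero coefficient in $v$, and $\langle v\rangle$ is the $G$-submodule of $F[S]$ generated by $v$, i.e. the $F$-linear span of the translates $vg$, $g\in G$. A nonempty subset $\Delta\subseteq S$ of a transitive $G$-set is a block if for every $g\in G$ either $\Delta g=\Delta$ or $\Delta g\cap\Delta=\emptyset$; the trivial blocks are $S$ and the one-point subsets. A transitive (nonempty) $G$-set is primitive if every block is trivial. *)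

(* Defs.v *)
From HB Require Import structures.
From mathcomp Require Import all_boot all_algebra.
From mathcomp Require Import boolp.

Set Implicit Arguments.
Unset Strict Implicit.
Unset Printing Implicit Defensive.

Import GRing.Theory.
Local Open Scope ring_scope.

(* The group is an arbitrary, possibly infinite, [groupType]; the actions of
   [action.v] require a [finGroupType]. *)
Record right_action (G : groupType) (S : Type) := RightAction {
  right_act :> S -> G -> S;
  right_act1 : forall x, right_act x 1%g = x;
  right_actM : forall x g h, right_act x (g * h)%g = right_act (right_act x g) h }.

Section GSet.
Variables (G : groupType) (S : finType) (to : right_action G S).

Lemma right_actK g : cancel (to^~ g) (to^~ g^-1%g).
Proof. by move=> x; rewrite -right_actM mulgV right_act1. Qed.

Lemma right_actVK g : cancel (to^~ g^-1%g) (to^~ g).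
Proof. by move=> x; rewrite -right_actM mulVg right_act1. Qed.

Lemma right_act_inj g : injective (to^~ g).
Proof. exact: can_inj (right_actK g). Qed.

Definition set_translate (D : {set S}) (g : G) : {set S} :=
  [set to x g | x in D].

Lemma set_translate1 D : set_translate D 1%g = D.
Proof.
by rewrite /set_translate (eq_imset _ (right_act1 to)); apply: imset_id.
Qed.

Lemma set_translateM D g h :
  set_translate D (g * h)%g = set_translate (set_translate D g) h.
Proof.
rewrite /set_translate -imset_comp; apply: eq_imset => x /=; exact: right_actM.
Qed.

Definition set_right_action : right_action G {set S} :=
  RightAction set_translate1 set_translateM.

Definition orbit_of (x : S) : {set S} := [set y | `[< exists g, y = to x g >]].

Definition transitive_gset : Prop :=
  (0 < #|S|)%N /\ forall x y, exists g, to x g = y.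

Definition is_block (D : {set S}) : Prop :=
  D != set0 /\
  forall g, set_translate D g = D \/ set_translate D g :&: D = set0.

Definition trivial_block (D : {set S}) : Prop :=
  D = [set: S] \/ exists x, D = [set x].

Definition primitive_gset : Prop :=
  transitive_gset /\ forall D, is_block D -> trivial_block D.

Definition doubly_transitive_on (X : {set S}) : Prop :=
  (1 < #|X|)%N /\
  forall a b c d, a \in X -> b \in X -> c \in X -> d \in X ->
    a != b -> c != d -> exists g, to a g = c /\ to b g = d.

End GSet.

(* The codomain is F^o, i.e. F as a vector space over itself, so that the
   pointwise structure makes F[S] a vectType over F. *)
Notation permmod F S := {ffun S -> F^o}.

Section PermutationModule.
Variables (F : fieldType) (S : finType).

Definition pt (x : S) : permmod F S := [ffun y => (y == x)%:R].

Definition supp (v : permmod F S) : {set S} :=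
  [set x | v x != 0].

Definition linear_ext (f : S -> S) (v : permmod F S) : permmod F S :=
  \sum_(x : S) v x *: pt (f x).

Variables (G : groupType) (to : right_action G S).

Definition translate (v : permmod F S) (g : G) : permmod F S := linear_ext (to^~ g) v.

(* <v> : the group may be infinite, so the translates of v are enumerated
   through the finitely many self-maps of S that are induced by some g. *)
Definition submodule_gen (v : permmod F S) : {vspace permmod F S} :=
  <<[seq linear_ext f v |
       f : {ffun S -> S} in [pred f : {ffun S -> S} |
                               `[< exists g, forall x, f x = to x g >]]]>>%VS.

Lemma eq_linear_ext f1 f2 v : f1 =1 f2 -> linear_ext f1 v = linear_ext f2 v.
Proof. by move=> eqf; apply: eq_bigr => x _; rewrite eqf. Qed.

Lemma translateE v g y :
  translate v g y = v (to y g^-1%g).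
Proof.
rewrite /translate /linear_ext sum_ffunE (bigD1 (to y g^-1%g)) //=.
rewrite !ffunE right_actVK eqxx /GRing.scale /= mulr1 big1 ?addr0 // => x neq.
rewrite !ffunE; case: eqP => [eq_y | _]; last exact: mulr0.
by case/eqP: neq; rewrite eq_y right_actK.
Qed.

Lemma supp_translate v g : supp (translate v g) = set_translate to (supp v) g.
Proof.
apply/setP => y; rewrite inE translateE; apply/idP/imsetP => [vy | [x + ->]].
  by exists (to y g^-1%g); rewrite ?inE // right_actVK.
by rewrite inE right_actK.
Qed.

Lemma submodule_genP v (U : {vspace permmod F S}) :
  reflect (forall g, translate v g \in U) (submodule_gen v <= U)%VS.
Proof.
apply: (iffP span_subvP) => [sub g | sub w /imageP[f + ->]].
  apply: sub; apply/imageP; exists [ffun x => to x g].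
    by rewrite inE; apply/asboolP; exists g => x; rewrite ffunE.
  by apply: eq_linear_ext => x; rewrite ffunE.
by rewrite inE => /asboolP[g fg]; rewrite (eq_linear_ext v fg); apply: sub.
Qed.

End PermutationModule.

(* Main.v *)
(* Choose translates b_1, ..., b_d of v spanning <v>. Every point lies in the
   support of some b_i, and at most one point lies in the support of b_i only:
   the coordinate functionals of two such points would be proportional on all
   translates, which primitivity forbids. Counting incidences gives
   t d + d >= 2 n, so in the extremal case every point lies in at most two of the
   supports and each b_i has exactly one private point. This holds for every such
   spanning family. Exchanging a b_i with a translate w = sum_i c_i b_i therefore
   forces, once two c_i are nonzero, that all of them are and that supp w is the
   set of private points. So Omega has d + 1 members, S is the set of pairs
   of members, and rescaled translates u_D with sum_D u_D = 0 satisfy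
   u_D(x) = - u_D'(x) at the point x of the intersection of D and D'.
   A group element maps u_D to m u_Dg with m independent of D, and primitivity
   yields m = 1 or m = -1. If -1 <> 1, then D -> D' iff u_D(x) = alpha is a
   tournament on Omega that each g preserves or reverses. In a doubly transitive
   group with such a tournament the stabilizer of a pair fixes a third vertex,
   so the stabilizer of a point of S is not maximal: a contradiction. *)

Require Import Defs.
From HB Require Import structures.
From mathcomp Require Import all_boot all_algebra all_fingroup all_solvable.
From mathcomp Require Import boolp zify.

Set Implicit Arguments.
Unset Strict Implicit.
Unset Printing Implicit Defensive.

(** * Tournaments preserved or reversed by a doubly transitive group *)

Section Tournament.
Local Open Scope group_scope.
Variables (T : finType) (r : rel T).
Hypothesis r_tournament : forall i j, i != j -> r j i = ~~ r i j.

Definition preserves (s : {perm T}) :=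
  [forall i, forall j, (i != j) ==> (r (s i) (s j) == r i j)].
Definition reverses (s : {perm T}) :=
  [forall i, forall j, (i != j) ==> (r (s i) (s j) == r j i)].

Lemma preservesP (s : {perm T}) :
  reflect (forall i j, i != j -> r (s i) (s j) = r i j) (preserves s).
Proof.
apply: (iffP forallP) => [h i j ij | h i].
  by have /forallP/(_ j)/implyP/(_ ij)/eqP := h i.
by apply/forallP => j; apply/implyP => ij; rewrite h.
Qed.

Lemma reversesP (s : {perm T}) :
  reflect (forall i j, i != j -> r (s i) (s j) = r j i) (reverses s).
Proof.
apply: (iffP forallP) => [h i j ij | h i].
  by have /forallP/(_ j)/implyP/(_ ij)/eqP := h i.
by apply/forallP => j; apply/implyP => ij; rewrite h.
Qed.

Lemma preservers_group_set : group_set [set s | preserves s].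
Proof.
apply/group_setP; split=> [|s u]; rewrite !inE.
  by apply/preservesP => i j _; rewrite !perm1.
move=> /preservesP hs /preservesP hu; apply/preservesP => i j ij.
by rewrite !permM hu ?(inj_eq perm_inj) // hs.
Qed.
Canonical preservers := Group preservers_group_set.

(** By Cauchy's theorem an even order would give an element [s] of order 2. It swaps some [i] with
    [s i] and so reverses the arc between them. *)
Lemma odd_preservers : odd #|preservers|.
Proof.
apply: contraT; rewrite -dvdn2 => /(Cauchy (isT : prime 2))[s].
rewrite inE => /preservesP sP s2.
have s2x x : s (s x) = x.
  by rewrite -permM -[s * s]/(s ^+ 2) -s2 expg_order perm1.
case: (altP (s =P 1)) s2 => [-> | s1]; first by rewrite order1.
have [i si | fix_s] := pickP (fun i => s i != i).
  by have := sP _ _ si; rewrite s2x r_tournament // => /esym; case: (r _ _).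
by case/eqP: s1; apply/permP => i; rewrite perm1; apply/eqP/negbFE/fix_s.
Qed.

Lemma reverses_fix_uniq (s : {perm T}) i j : reverses s -> s i = i -> s j = j -> i = j.
Proof.
move=> /reversesP rs si sj; apply/eqP; apply: contraT => ij.
by have := rs _ _ ij; rewrite si sj r_tournament 1?eq_sym //; case: (r _ _).
Qed.

Lemma reversesM_preserves s u :
  reverses s -> preserves u -> reverses (s * u).
Proof.
move=> /reversesP hs /preservesP hu; apply/reversesP => i j ij.
by rewrite !permM hu ?(inj_eq perm_inj) // hs.
Qed.

Lemma preservesJ (s g : {perm T}) :
  preserves g || reverses g -> preserves s -> preserves (s ^ g).
Proof.
move=> pg /preservesP ps; apply/preservesP => a b.
rewrite -[a](permKV g) -[b](permKV g) (inj_eq perm_inj) !permJ => ab.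
have sab : s (g^-1 a) != s (g^-1 b) by rewrite (inj_eq perm_inj).
by case/orP: pg => [/preservesP pg | /reversesP pg]; rewrite !pg ?ps // eq_sym.
Qed.

Lemma reversesJ (s g : {perm T}) :
  preserves g || reverses g -> reverses s -> reverses (s ^ g).
Proof.
move=> pg /reversesP rs; apply/reversesP => a b.
rewrite -[a](permKV g) -[b](permKV g) (inj_eq perm_inj) !permJ => ab.
have sab : s (g^-1 a) != s (g^-1 b) by rewrite (inj_eq perm_inj).
by case/orP: pg => [/preservesP pg | /reversesP pg]; rewrite !pg ?rs // eq_sym.
Qed.

Lemma reverses2_preserves s : reverses s -> preserves (s ^+ 2).
Proof.
move=> /reversesP hs; apply/preservesP => i j ij.
by rewrite expgS expg1 !permM hs ?(inj_eq perm_inj) // hs // eq_sym.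
Qed.

(** Let [m] be the order of [g ^+ 2], which is odd because [g ^+ 2] preserves [r]; then [g ^+ m] has
    trivial square. It is written as a reverser times a preserver, a form that acts like [g] on the
    points that [g] fixes or swaps. *)
Lemma reverses_involution (G : {group {perm T}}) g :
  g \in G -> reverses g ->
  exists k, let h := g * (g ^+ 2) ^+ k in
    [/\ h \in G, reverses h & h ^+ 2 = 1].
Proof.
move=> Gg rg; have pg2 := reverses2_preserves rg.
have og : odd #[g ^+ 2].
  have: #[g ^+ 2] %| #|preservers| by apply: order_dvdG; rewrite inE.
  move/dvdnP=> [q]; move: odd_preservers => + eq_o.
  by rewrite eq_o oddM => /andP[].
exists #[g ^+ 2]./2; split.
- by rewrite groupM // !groupX.
- apply: reversesM_preserves => //.
  have : (g ^+ 2) ^+ #[g ^+ 2]./2 \in preservers by rewrite groupX // inE.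
  by rewrite inE.
- rewrite -expgM -expgS -expgM (mulnC _ 2%N) expgM -[RHS](expg_order (g ^+ 2)).
  by congr (_ ^+ _); rewrite -[RHS]odd_double_half og add1n -muln2 mulnC.
Qed.

(** Coprime action: [<[h]>] has order at most 2 and normalizes the group [H] of odd order. *)
Lemma involution_stable_Sylow p (h : {perm T}) (H : {group {perm T}}) :
  h ^+ 2 = 1 -> odd #|H| -> h \in 'N(H) ->
  exists2 Q : {group {perm T}}, p.-Sylow(H) Q & h \in 'N(Q).
Proof.
move=> h2 oddH nHh.
have solh : solvable <[h]> by exact/abelian_sol/cycle_abelian.
have coHh : coprime #|H| #|<[h]>|.
  rewrite coprime_sym -[#|<[h]>|]/(#[h]); apply: (@coprime_dvdl _ 2).
    by rewrite order_dvdn h2.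
  by rewrite coprime2n.
have nHh' : <[h]> \subset 'N(H) by rewrite cycle_subG.
have [Q sylQ nQh] := sol_coprime_Sylow_exists p solh nHh' coHh.
by exists Q; rewrite -?cycle_subG.
Qed.

Lemma fix_conjg (A : {set {perm T}}) (s : {perm T}) x :
  (s x \in 'Fix_'P(A :^ s)) = (x \in 'Fix_'P(A)).
Proof.
apply/afixP/afixP => fixA a Aa.
  have := fixA (a ^ s); rewrite /= /aperm memJ_conjg => /(_ Aa).
  by rewrite permJ => /perm_inj.
case/imsetP: Aa => b Ab ->; have := fixA b Ab.
by rewrite /= /aperm permJ => ->.
Qed.

(* Since the preservers have odd order, some involution h in G swaps i and j, and
   it fixes a unique c in X. By induction on X, every h-stable Sylow subgroup Q of
   the pointwise stabilizer L of i and j fixes c, hence so does L: the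
   normalizer of Q in G is doubly transitive on the points of X fixed by Q. *)
Lemma pair_fixpoint (G : {group {perm T}}) (X : {set T}) :
    (forall s, s \in G -> preserves s || reverses s) ->
    (forall s x, s \in G -> x \in X -> s x \in X) ->
    (forall a b c d, a \in X -> b \in X -> c \in X -> d \in X ->
       a != b -> c != d -> exists s, [/\ s \in G, s a = c & s b = d]) ->
    (2 < #|X|)%N ->
  forall i j, i \in X -> j \in X -> i != j ->
    exists2 c, c \in X &
      forall s : {perm T}, s \in G -> [set s i; s j] = [set i; j] -> s c = c.
Proof.
have [m] := ubnP #|X|; elim: m G X => // m IH G X ltXm Gpr GX G2 X_gt2 i j Xi Xj ij.
have rev_arc s a b : s \in G -> a != b -> r (s a) (s b) = ~~ r a b -> reverses s.
  move=> Gs ab; have /orP[/preservesP-> | //] := Gpr s Gs => //.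
  by case: (r _ _).
have swap_rev s a b : s \in G -> a != b -> s a = b -> s b = a -> reverses s.
  by move=> Gs ab sa sb; apply: (rev_arc s a b); rewrite // sa sb r_tournament.
have fix2_pres s a b : s \in G -> a != b -> s a = a -> s b = b -> preserves s.
  move=> Gs ab sa sb; have /orP[// | rs] := Gpr s Gs.
  by case/eqP: ab; apply: reverses_fix_uniq rs sa sb.
have actsX (A : {group {perm T}}) : A \subset G -> [acts A, on X | 'P].
  move=> sAG; apply/subsetP => s As; rewrite !inE; apply/subsetP => x Xx.
  by rewrite inE; apply: GX; rewrite ?(subsetP sAG).
have cycle_odd h : h \in G -> h ^+ 2 = 1 ->
    #|X| = #|'Fix_(X | 'P)(<[h]>)| %[mod 2].
  move=> Gh h2; apply: pgroup_fix_mod; last by apply: actsX; rewrite cycle_subG.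
  rewrite /pgroup -[#|_|]/(#[h]); apply: (@pnat_dvd _ 2); last by [].
  by rewrite order_dvdn h2.
have Fix1 h x : x \in 'Fix_(X | 'P)(<[h]>) -> x \in X /\ h x = x.
  by case/setIP=> Xx /afixP/(_ h (cycle_id h)).
(* Among any three vertices one has both an arc out and an arc in: the middle of a transitive
   triple, or any vertex of a cyclic one. Moving [(i0, j0)] to [(i0, k0)] then yields a reverser
   that fixes [i0]. *)
have [i0 [j0 [k0 [Xi0 Xj0 Xk0 [ij0 ik0 rij0 rik0]]]]] : exists a b c,
    [/\ a \in X, b \in X, c \in X & [/\ a != b, a != c, r a b & ~~ r a c]].
  have [z]: exists z, z \in X :\ i :\ j.
    by apply/set0Pn; rewrite -card_gt0; move: X_gt2;
       rewrite (cardsD1 i) Xi (cardsD1 j) !inE eq_sym ij Xj.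
  rewrite !inE => /and3P[zj zi Xz].
  have [ji iz jz] : [/\ j != i, i != z & j != z] by rewrite ![_ == z]eq_sym eq_sym.
  have := (r_tournament ij, r_tournament iz, r_tournament jz).
  case rij : (r i j); case riz : (r i z); case rjz : (r j z);
  move=> [[/= rji rzi] rzj];
  first [ by exists i, j, z; rewrite ?rij ?riz
        | by exists i, z, j; rewrite ?rij ?riz
        | by exists j, z, i; rewrite ?rji ?rjz
        | by exists j, i, z; rewrite ?rji ?rjz
        | by exists z, j, i; rewrite ?rzj ?rzi
        | by exists z, i, j; rewrite ?rzj ?rzi].
have [h0 [Gh0 rh0 h02 h0i]] : exists h,
    [/\ h \in G, reverses h, h ^+ 2 = 1 & h i0 = i0].
  have [g [Gg gi gj]] := G2 _ _ _ _ Xi0 Xj0 Xi0 Xk0 ij0 ik0.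
  have rg : reverses g by apply: (rev_arc g i0 j0); rewrite // gi gj rij0 (negPf rik0).
  have [k [Gh rh h2]] := reverses_involution Gg rg.
  exists (g * (g ^+ 2) ^+ k); split=> //.
  have fixX (u : {perm T}) n : u i0 = i0 -> (u ^+ n) i0 = i0.
    by move=> ui; elim: n => [|n IHn]; rewrite ?perm1 // expgS permM ui.
  by rewrite permM gi fixX // fixX.
(* The reverser [h0] has [i0] as its only fixed point, since the arc between two fixed points cannot
   be reversed. *)
have oddX : odd #|X|.
  suffices eqX : #|'Fix_(X | 'P)(<[h0]>)| = 1%N.
    by have /eqP := cycle_odd h0 Gh0 h02; rewrite eqX !modn2; case: (odd _).
  apply/eqP/cards1P; exists i0; apply/setP => x.
  apply/idP/set1P => [/Fix1[_ h0x] | ->].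
    exact: reverses_fix_uniq rh0 h0x h0i.
  by rewrite inE Xi0 -sub_astab1 cycle_subG; apply/astab1P.
have [h [Gh rh h2 hi hj]] : exists h,
    [/\ h \in G, reverses h, h ^+ 2 = 1, h i = j & h j = i].
  have ji : j != i by rewrite eq_sym.
  have [g [Gg gi gj]] := G2 _ _ _ _ Xi Xj Xj Xi ij ji.
  have rg := swap_rev g i j Gg ij gi gj.
  have [k [Gh rh h2]] := reverses_involution Gg rg.
  exists (g * (g ^+ 2) ^+ k).
  have fixX (u : {perm T}) x n : u x = x -> (u ^+ n) x = x.
    by move=> ui; elim: n => [|n IHn]; rewrite ?perm1 // expgS permM ui.
  by split=> //; rewrite permM ?gi ?gj fixX // expgS expg1 permM ?gi ?gj ?gi.
have [c Xc hc] : exists2 c, c \in X & h c = c.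
  have := cycle_odd h Gh h2; rewrite !modn2 oddX.
  case: (set_0Vmem 'Fix_(X | 'P)(<[h]>)) => [-> | [c /Fix1[Xc hc]] _]; last by exists c.
  by rewrite cards0.
exists c => // s Gs sij.
pose L := 'C_G([set i; j] | 'P)%G.
have sLK : L \subset preservers.
  apply/subsetP => u /setIP[Gu /astabP fix_u]; rewrite inE.
  by apply: (fix2_pres u i j) => //; apply: fix_u; rewrite !inE eqxx ?orbT.
have oddL : odd #|L| := dvdn_odd (cardSg sLK) odd_preservers.
have nLh : h \in 'N(L).
  apply/normP/eqP; rewrite eqEcard cardJg leqnn andbT.
  apply/subsetP => u /imsetP[l /setIP[Gl /astabP fix_l] ->].
  have [li lj] : l i = i /\ l j = j by split; apply: fix_l; rewrite !inE eqxx ?orbT.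
  have hV : h^-1 = h by apply/eqP; rewrite eq_invg_mul -[h * h]/(h ^+ 2) h2.
  rewrite inE groupJ //=; apply/astabP => x; rewrite !inE.
  by case/orP=> /eqP->; rewrite /= /aperm conjgE hV !permM ?hi ?hj ?li ?lj ?hi ?hj.
(* For every prime [p] the stabilizer of [c] in [L] then contains a Sylow [p]-subgroup of [L], so it
   is all of [L]. If [s] swaps [i] and [j], then [s * h] lies in [L], and [h] fixes [c]. *)
suffices fixQ p (Q : {group {perm T}}) : prime p -> p.-Sylow(L) Q ->
    h \in 'N(Q) -> c \in 'Fix_'P(Q).
  have sLc : L \subset 'C[c | 'P].
    suffices: #|L| %| #|'C_L[c | 'P]|.
      move=> dv; have /eqP <- : 'C_L[c | 'P] == L; last exact: subsetIr.
      by rewrite eqEcard subsetIl dvdn_leq.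
    apply/dvdn_partP => // p; rewrite mem_primes => /andP[pr_p _].
    have [Q sylQ nQh] := involution_stable_Sylow p h2 oddL nLh.
    rewrite -(card_Hall sylQ); apply: cardSg.
    by rewrite subsetI (pHall_sub sylQ) sub_astab1 (fixQ p).
  have inL (u : {perm T}) : u \in G -> u i = i -> u j = j -> u c = c.
    move=> Gu ui uj; suffices /(subsetP sLc)/astab1P : u \in L by [].
    by rewrite inE Gu; apply/astabP => x; rewrite !inE => /orP[] /eqP->.
  have /set2P si : s i \in [set i; j] by rewrite -sij set21.
  have /set2P sj : s j \in [set i; j] by rewrite -sij set22.
  have sne : s i != s j by rewrite (inj_eq perm_inj).
  case: si sj sne => si [] sj; rewrite si sj ?eqxx // => _; first exact: inL.
  apply: (@perm_inj _ h); rewrite hc -permM.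
  by apply: inL; rewrite ?groupM // permM ?si ?sj ?hi ?hj.
move=> pr_p sylQ nQh; pose Y := 'Fix_(X | 'P)(Q).
have pQ := pHall_pgroup sylQ; have sQL := pHall_sub sylQ.
have sQG : Q \subset G := subset_trans sQL (subsetIl _ _).
have [sXY | /subsetPn[x0 Xx0 Yx0]] := boolP (X \subset 'Fix_'P(Q)).
  exact: (subsetP sXY).
have ltYX : (#|Y| < #|X|)%N.
  apply: proper_card; rewrite properE subsetIl; apply/subsetPn; exists x0 => //.
  by rewrite inE negb_and Yx0 orbT.
have [Yi Yj] : i \in Y /\ j \in Y.
  split; apply/setIP; split=> //; apply/afixP => q /(subsetP sQL)/setIP[_ /astabP];
  by apply; rewrite !inE eqxx ?orbT.
have [Y_gt2 | Y_le2] := ltnP 2 #|Y|.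
  (* If [g] moves [(i, j)] to [(a, b)], then [Q] and [Q :^ g] are both Sylow subgroups of the
     pointwise stabilizer of [a] and [b]. Some [l] in it conjugates [Q :^ g] to [Q], and [g * l]
     normalizes [Q]. *)
  have trY a b : a \in Y -> b \in Y -> a != b ->
      exists s, [/\ s \in 'N_G(Q), s i = a & s j = b].
    case/setIP=> Xa Fa /setIP[Xb Fb] ab.
    have [g [Gg gi gj]] := G2 _ _ _ _ Xi Xj Xa Xb ij ab.
    have conjL : (L :^ g)%g = 'C_G([set a; b] | 'P).
      rewrite conjIg conjGid // -astab_setact setactE imsetU1 imset_set1.
      by rewrite /= /aperm gi gj.
    have sylQ1 : p.-Sylow(L :^ g) Q.
      rewrite pHallE cardJg -(card_Hall sylQ) eqxx andbT /= conjL subsetI sQG.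
      apply/subsetP => q Qq; apply/astabP => x; rewrite !inE.
      by case/orP=> /eqP->; [have /afixP := Fa | have /afixP := Fb]; apply.
    have sylQ2 : p.-Sylow(L :^ g) (Q :^ g) by rewrite pHallJ2.
    have [l] := Sylow_trans sylQ2 sylQ1.
    rewrite /= conjL => /setIP[Gl /astabP fix_l] /= defQ.
    have [la lb] : l a = a /\ l b = b by split; apply: fix_l; rewrite !inE eqxx ?orbT.
    exists (g * l); rewrite !permM gi gj; split=> //.
    by rewrite inE groupM // inE conjsgM -defQ subxx.
  have [||||c' Yc' fix_c'] := IH 'N_G(Q)%G Y _ _ _ _ Y_gt2 i j Yi Yj ij.
  - exact: leq_trans ltYX _.
  - by move=> u /setIP[Gu _]; apply: Gpr.
  - move=> u x /setIP[Gu nQu] /setIP[Xx Fx]; rewrite inE GX //=.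
    by rewrite -(normP nQu) fix_conjg.
  - move=> a b a' b' Ya Yb Ya' Yb' ab ab'.
    have [u [Nu ui uj]] := trY a b Ya Yb ab.
    have [u' [Nu' ui' uj']] := trY a' b' Ya' Yb' ab'.
    by exists (u^-1 * u'); rewrite groupM ?groupV // !permM -ui -uj !permK.
  (* The element [h] normalizes [Q] and swaps [i] and [j], so the induction hypothesis applies to
     it; uniqueness of its fixed point gives [c' = c]. *)
  have hc' : h c' = c'.
    by apply: fix_c'; rewrite ?hi ?hj 1?setUC // inE Gh.
  by rewrite (reverses_fix_uniq rh hc hc'); case/setIP: Yc'.
(* Q is a Sylow subgroup of the preservers fixing i, so an involution h' of G
   fixing i stabilizes the set of the two fixed points of a conjugate of Q, one of
   which is i; but h' has only one fixed point. *)
have defY : Y = [set i; j].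
  apply/esym/eqP; rewrite eqEcard cards2 ij Y_le2 andbT.
  by apply/subsetP => x /set2P[] ->.
have modX : #|X| = 2 %[mod p].
  by rewrite (pgroup_fix_mod pQ (actsX _ sQG)) -/Y defY cards2 ij.
have [g [Gg gi0 _]] := G2 _ _ _ _ Xi0 Xj0 Xi Xj ij0 ij.
pose h' := h0 ^ g; pose H := ('C_G[i | 'P] :&: preservers)%G.
have h'i : h' i = i by rewrite -gi0 permJ h0i.
have rh' : reverses h' by apply: reversesJ => //; apply: Gpr.
have h'2 : h' ^+ 2 = 1 by rewrite -conjXg h02 conj1g.
have Gh' : h' \in G by rewrite groupJ.
have sHK : H \subset preservers by apply: subsetIr.
have nHh' : h' \in 'N(H).
  apply/normP/eqP; rewrite eqEcard cardJg leqnn andbT.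
  apply/subsetP => u /imsetP[l /setIP[/setIP[Gl /astab1P li]]].
  rewrite inE => pl ->; rewrite in_setI; apply/andP; split; last first.
    by rewrite inE preservesJ ?Gpr.
  rewrite in_setI groupJ //=.
  by apply/astab1P; rewrite /= /aperm -h'i permJ; congr (h' _).
have sLC : L \subset 'C_G[i | 'P] by rewrite setIS // astabS // sub1set set21.
have sLH : L \subset H by rewrite subsetI sLC.
have defL : 'C_('C_G[i | 'P])[j | 'P] = L.
  by rewrite -setIA -astabU.
have indexL : #|'C_G[i | 'P] : L| = #|X|.-1.
  rewrite -defL -card_orbit (cardsD1 i X) Xi /=; congr #|pred_of_set _|.
  apply/setP => x; rewrite in_setD1; apply/orbitP/andP => [[u] | [xi Xx]].
    case/setIP=> Gu /astab1P ui <-; rewrite /= /aperm; split; last exact: GX.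
    by rewrite -[X in _ != X]ui (inj_eq perm_inj) eq_sym.
  have [u [Gu ui uj]] : exists u, [/\ u \in G, u i = i & u j = x].
    by apply: G2 => //; rewrite eq_sym.
  by exists u => //; rewrite inE Gu; apply/astab1P.
(* By [modX] the prime [p] divides [#|X| - 2], hence not the index [#|X| - 1]; so the Sylow subgroup
   [Q] of [L] is also one of [H]. *)
have p'index : p^'.-nat #|'C_G[i | 'P] : L|.
  rewrite indexL p'natE //; apply/negP => pdv.
  have : p %| #|X|.-1.+1 - 2.
    by rewrite prednK ?(ltn_trans _ X_gt2) // -eqn_mod_dvd ?(ltnW X_gt2) //; apply/eqP.
  rewrite subn2 /= => pdv1; have := dvdn_sub pdv pdv1.
  rewrite -{1}(prednK (_ : 0 < #|X|.-1)%N); last first.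
    by rewrite -ltnS prednK ?(ltn_trans _ X_gt2) // ltnW.
  by rewrite subSnn dvdn1 => /eqP p1; rewrite p1 in pr_p.
have sylQH : p.-Sylow(H) Q.
  rewrite /pHall (subset_trans sQL sLH) pQ -(Lagrange_index sLH sQL) pnatM.
  have /and3P[_ _ ->] := sylQ; rewrite andbT.
  apply: pnat_dvd p'index; rewrite -(Lagrange_index (subsetIl _ _) sLH).
  by rewrite dvdn_mull.
have oddH : odd #|H| := dvdn_odd (cardSg sHK) odd_preservers.
have [R sylR nRh'] := involution_stable_Sylow p h'2 oddH nHh'.
have [x Hx defR] := Sylow_trans sylQH sylR.
have xi : x i = i by case/setIP: Hx => /setIP[_ /astab1P].
have Gx : x \in G by case/setIP: Hx => /setIP[].
have Fxj : x j \in 'Fix_'P(R) by rewrite defR fix_conjg; case/setIP: Yj.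
have Fhxj : h' (x j) \in 'Fix_'P(R) by rewrite -(normP nRh') fix_conjg.
(* Since [h'] normalizes [R = Q :^ x], it permutes the two points [x i = i] and [x j] of [X] that
   [R] fixes. It fixes [i], so it would fix [x j] too. *)
have : x^-1 (h' (x j)) \in Y.
  rewrite inE !GX ?groupV //=.
  by rewrite -(fix_conjg _ x) permKV -defR.
have xij : x i != x j by rewrite (inj_eq perm_inj).
rewrite defY => /set2P[] /(congr1 x); rewrite permKV.
  by move/eqP; rewrite xi -[X in _ == X]h'i (inj_eq perm_inj) -xi eq_sym (negPf xij).
by move=> h'xj; move: xij; rewrite xi (reverses_fix_uniq rh' h'i h'xj) eqxx.
Qed.

End Tournament.

Import GRing.Theory.
Local Open Scope ring_scope.

(** * Primitive actions *)

Section Primitive.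
Variables (G : groupType) (S : finType) (to : right_action G S).
Hypothesis primS : primitive_gset to.

(** Each class of an invariant equivalence relation is a block, hence all of [S] or a single
    point. *)
Lemma primitive_congruence (E : S -> S -> Prop) :
  (forall x, E x x) -> (forall x y, E x y -> E y x) ->
  (forall x y z, E x y -> E y z -> E x z) ->
  (forall x y g, E x y -> E (to x g) (to y g)) ->
  (forall x y, E x y) \/ (forall x y, E x y -> x = y).
Proof.
move=> Er Es Et Eg; have [_ primB] := primS.
pose D x := [set y | `[< E x y >]].
have DP x y : (y \in D x) <-> E x y by rewrite inE; split=> /asboolP.
have blockD x : is_block to (D x).
  split=> [|g]; first by apply/set0Pn; exists x; apply/DP.
  have [xg | nxg] := pselect (E x (to x g)); [left | right].
    apply/setP => y; apply/imsetP/idP => [[z /DP xz ->] | /DP xy].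
      by apply/DP/(Et _ _ _ xg)/Eg.
    exists (to y g^-1%g); last by rewrite right_actVK.
    by apply/DP; rewrite -[x](right_actK to g); apply/Eg/(Et _ x) => //; apply: Es.
  apply/setP => y; rewrite in_set0 in_setI; apply/negP.
  case/andP=> /imsetP[z /DP xz ->] /DP xzg.
  by apply: nxg; apply: Et xzg _; apply/Es/Eg.
have [[x Dx] | noT] := pselect (exists x, D x = setT); [left | right].
  have Ex y : E x y by apply/DP; rewrite Dx inE.
  by move=> y z; apply: (Et _ x) => //; apply: Es.
move=> x y xy; have [Dx | [z Dx]] := primB _ (blockD x).
  by case: noT; exists x.
have /DP : E x x by []. have /DP := xy.
by rewrite Dx !inE => /eqP-> /eqP->.
Qed.

(** Maximality of point stabilizers, in terms of orbits: for a subgroup [P] that contains the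
    stabilizer of [x], the [P]-orbit of [x] is a block. *)
Lemma primitive_overgroup (P : G -> Prop) x :
  (forall g h, P g -> P h -> P (g * h)%g) -> (forall g, P g -> P g^-1%g) ->
  (forall g, to x g = x -> P g) ->
  (forall y, exists2 g, P g & to x g = y) \/ (forall g, P g -> to x g = x).
Proof.
move=> PM PV Px; have [_ primB] := primS.
pose D := [set y | `[< exists2 g, P g & to x g = y >]].
have DP y : (y \in D) <-> exists2 g, P g & to x g = y by rewrite inE; split=> /asboolP.
have P1 : P 1%g by apply: Px; rewrite right_act1.
have Dx : x \in D by apply/DP; exists 1%g; rewrite ?right_act1.
have blockD : is_block to D.
  split=> [|g]; first by apply/set0Pn; exists x.
  have [Pg | nPg] := pselect (P g); [left | right].
    apply/setP => y; apply/imsetP/idP => [[z /DP[h Ph <-] ->] | /DP[h Ph <-]].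
      by apply/DP; exists (h * g)%g; rewrite ?right_actM //; apply: PM.
    exists (to x (h * g^-1)%g); last by rewrite right_actM right_actVK.
    by apply/DP; exists (h * g^-1)%g => //; apply/PM/PV.
  apply/setP => y; rewrite in_set0 in_setI; apply/negP.
  case/andP=> /imsetP[z /DP[h Ph <-] ->] /DP[k Pk xk].
  case: nPg; have -> : g = (h^-1 * (h * g * k^-1) * k)%g.
    by rewrite -!mulgA mulVg mulg1 mulKg.
  apply/(PM _ _ _ Pk)/PM; first exact: PV.
  by apply: Px; rewrite right_actM right_actM -xk right_actK.
have [DT | [z Dz]] := primB _ blockD; [left => y | right => g Pg].
  by apply/DP; rewrite DT inE.
have : to x g \in D by apply/DP; exists g.
by move: Dx; rewrite Dz !inE => /eqP-> /eqP.
Qed.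

End Primitive.

(** * Equality in a sum of inequalities, and bases inside a spanning sequence *)

Lemma eq_sum_pointwise (I : finType) (E1 E2 : I -> nat) :
  (forall i, E1 i <= E2 i)%N -> (\sum_i E2 i <= \sum_i E1 i)%N -> E1 =1 E2.
Proof.
move=> le12 le21 i; apply/eqP.
have := @leqif_sum _ predT (fun i => E1 i == E2 i) E1 E2 (fun i _ => leqif_eq (le12 i)).
case=> le /esym; rewrite eqn_leq le le21 => /forallP/(_ i)/implyP; exact.
Qed.

Lemma free_subseq (K : fieldType) (vT : vectType K) (X : seq vT) :
  exists Y, [/\ subseq Y X, free Y & <<Y>>%VS = <<X>>%VS].
Proof.
elim: X => [|x X [Y [sYX freeY spanY]]].
  by exists [::]; rewrite nil_free.
have [xY | xY] := boolP (x \in <<Y>>%VS).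
  exists Y; split=> //; first exact: subseq_trans sYX (subseq_cons _ _).
  by rewrite span_cons -spanY; apply/esym/addv_idPr; rewrite -memvE.
exists (x :: Y); rewrite free_cons xY freeY !span_cons spanY; split=> //.
by rewrite /= eqxx.
Qed.

(** * The extremal case *)

Section Translates.
Variables (G : groupType) (S : finType) (to : right_action G S).
Variables (F : fieldType) (v : permmod F S).

Definition spanning_translates d (b : 'I_d -> permmod F S) : Prop :=
  (forall i, exists g, b i = translate to v g) /\
  (forall g, exists c : 'I_d -> F, translate to v g = \sum_i c i *: b i).

Lemma exists_spanning_translates :
  exists b : 'I_(\dim (submodule_gen to v)) -> permmod F S, spanning_translates b.
Proof.
rewrite /submodule_gen; set X := [seq _ | f in _].
have [Y [sYX freeY spanY]] := free_subseq X.
rewrite -spanY (eqP freeY); exists (fun i => Y`_i); split=> [i | g].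
  have : Y`_i \in X by apply: (mem_subseq sYX); apply: mem_nth.
  case/imageP=> f; rewrite inE => /asboolP[g fg] ->; exists g.
  exact: eq_linear_ext.
have : translate to v g \in <<in_tuple Y>>%VS.
  by rewrite /= spanY; move: g; apply/submodule_genP/subvv.
by move/coord_span => eq_g; exists (fun i => coord (in_tuple Y) i (translate to v g)).
Qed.

Lemma sum_scaleE d (c : 'I_d -> F) (b : 'I_d -> permmod F S) x :
  (\sum_i c i *: b i) x = \sum_i c i * b i x.
Proof. by rewrite sum_ffunE; apply: eq_bigr => i _; rewrite ffunE. Qed.

End Translates.

Section Equality.
Variables (G : groupType) (S : finType) (to : right_action G S).
Variables (F : fieldType) (v : permmod F S).
Hypothesis primS : primitive_gset to.
Hypothesis supp_gt1 : (1 < #|supp v|)%N.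
Hypothesis supp_lt : (#|supp v| < #|S|)%N.

Lemma translateM g h :
  translate to (translate to v g) h = translate to v (g * h)%g.
Proof. by apply/ffunP => y; rewrite !translateE invgM right_actM. Qed.

Lemma card_supp_translate g : #|supp (translate to v g)| = #|supp v|.
Proof. by rewrite supp_translate card_imset //; apply: right_act_inj. Qed.

Lemma translate_neq0 x : exists g, translate to v g x != 0.
Proof.
have [[_ tr] _] := primS.
have /card_gt0P[y vy] : (0 < #|supp v|)%N by apply: ltnW.
have [g <-] := tr y x; exists g.
by rewrite translateE right_actK -[_ != 0]/(_ != 0); move: vy; rewrite inE.
Qed.

(** Proportionality of the coordinates at two points, over all translates, is a congruence. If it
    related all points, [v] would vanish nowhere, against [supp_lt]. *)
Lemma translates_separate x y a :
  a != 0 -> (forall g, translate to v g y = a * translate to v g x) -> x = y.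
Proof.
move=> a0 eq_xy.
pose E x y := exists2 a, a != 0 &
  forall g, translate to v g y = a * translate to v g x.
have [||||allE|eqE] := @primitive_congruence G S to primS E.
- by move=> z; exists 1; rewrite ?oner_neq0 // => g; rewrite mul1r.
- move=> z1 z2 [c c0 eq_c]; exists c^-1; rewrite ?invr_neq0 // => g.
  by rewrite eq_c mulKf.
- move=> z1 z2 z3 [c c0 eq_c] [e e0 eq_e]; exists (e * c); rewrite ?mulf_neq0 // => g.
  by rewrite eq_e eq_c mulrA.
- move=> z1 z2 g [c c0 eq_c]; exists c => // h.
  have := eq_c (h * g^-1)%g; rewrite !translateE invgM invgK !right_actM.
  by [].
- have /card_gt0P[z] : (0 < #|supp v|)%N by apply: ltnW.
  rewrite inE => vz; move: supp_lt; rewrite ltnNge => /negP[].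
  rewrite -cardsT; apply: subset_leq_card; apply/subsetP => z' _; rewrite inE.
  have [c c0 /(_ 1%g)] := allE z z'.
  by rewrite !translateE invg1 !right_act1 => ->; rewrite mulf_neq0.
by apply: eqE; exists a.
Qed.

(** * Counting the points covered by a spanning family of translates *)

Section Cover.
Variables (d : nat) (b : 'I_d -> permmod F S).
Hypothesis spanb : spanning_translates to v b.

Definition private i x := (b i x != 0) && [forall j, (j != i) ==> (b j x == 0)].

Lemma privateP i x :
  reflect (b i x != 0 /\ forall j, j != i -> b j x = 0) (private i x).
Proof.
apply: (iffP andP) => [[bi /forallP h]|[bi h]]; split=> //.
  by move=> j ji; apply/eqP; have /implyP := h j; apply.
by apply/forallP => j; apply/implyP => ji; rewrite h.
Qed.

Lemma private_coord i x (c : 'I_d -> F) :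
  private i x -> (\sum_j c j *: b j) x = c i * b i x.
Proof.
case/privateP=> _ b0; rewrite sum_scaleE (bigD1 i) //= big1 ?addr0 // => j ji.
by rewrite b0 // mulr0.
Qed.

(** At a private point of [b i] the value of a combination depends on its [i]-th coefficient only,
    so the coordinates at [x] and [y] are proportional. *)
Lemma private_uniq i x y : private i x -> private i y -> x = y.
Proof.
move=> px py; have [[bx _] [b_y _]] := (privateP i x px, privateP i y py).
apply: (@translates_separate x y (b i y / b i x)) => [|g].
  by rewrite mulf_neq0 ?invr_neq0.
have [_ /(_ g)[c ->]] := spanb.
by rewrite !(private_coord c px, private_coord c py) [RHS]mulrCA divfK.
Qed.

Lemma covered x : exists i, b i x != 0.
Proof.
apply/existsP; apply: contraT; rewrite negb_exists => /forallP b0.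
have [g] := translate_neq0 x; have [_ /(_ g)[c ->]] := spanb.
rewrite sum_scaleE big1 ?eqxx // => i _.
by have := b0 i; rewrite negbK => /eqP->; rewrite mulr0.
Qed.

Hypothesis extremal : ((#|supp v| + 1) * d = 2 * #|S|)%N.

Let cov x := #|[set i | b i x != 0]|.

Lemma private_cov x : (cov x == 1)%N = (\sum_i private i x)%N :> nat.
Proof.
have [/cards1P[i eq_i] | cov1] := boolP (cov x == 1)%N.
  have px : private i x.
    have mem_i j : (b j x != 0) = (j == i).
      by move/setP: eq_i => /(_ j); rewrite !inE.
    apply/privateP; split=> [|j]; first by rewrite mem_i.
    by move/negPf; rewrite -mem_i => /negbFE/eqP.
  rewrite (bigD1 i) //= px big1 // => j ji; apply/eqP; rewrite eqb0.
  apply/negP => /privateP[_ /(_ i)] b0; have /privateP[/eqP[]] := px.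
  by apply: b0; rewrite eq_sym.
rewrite big1 // => i _; apply/eqP; rewrite eqb0; apply: contra cov1 => /privateP[bi b0].
apply/cards1P; exists i; apply/setP => j; rewrite !inE.
by have [-> | /b0->] := eqVneq j i; rewrite ?bi ?eqxx.
Qed.

(** Every point has [cov x + (cov x == 1) >= 2], and these terms sum to at most [t d + d], with [t]
    the size of [supp v], because each [b i] has at most one private point. As [t d + d = 2 n], with
    [n] the number of points, all these inequalities are equalities. *)
Lemma extremal_cover :
  (forall x, cov x <= 2)%N /\ (forall i, exists x, private i x).
Proof.
have sum_cov : (\sum_x cov x = #|supp v| * d)%N.
  rewrite /cov (eq_bigr (fun x => \sum_i nat_of_bool (b i x != 0%R))); last first.
    by move=> x _; rewrite -sum1dep_card big_mkcond.
  rewrite exchange_big /= (eq_bigr (fun=> #|supp v|)).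
    by rewrite sum_nat_const card_ord mulnC.
  move=> i _; have [[g ->] _] := (spanb.1 i, tt).
  by rewrite -(card_supp_translate g) -sum1dep_card [RHS]big_mkcond.
have sum_priv : (\sum_x (cov x == 1) = \sum_i #|[set x | private i x]|)%N.
  rewrite (eq_bigr _ (fun x _ => private_cov x)) exchange_big /=.
  by apply: eq_bigr => i _; rewrite -sum1dep_card [RHS]big_mkcond.
have priv_le1 i : (#|[set x | private i x]| <= 1)%N.
  apply/card_le1_eqP => x y; rewrite !inE => px py; exact: private_uniq py px.
have cov_ge x : (2 <= cov x + (cov x == 1))%N.
  have : (0 < cov x)%N.
    have [i bi] := covered x; rewrite card_gt0; apply/set0Pn; exists i; by rewrite inE.
  by case: (cov x) => [|[|]].
have sumD : (\sum_x (cov x + (cov x == 1)) =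
             #|supp v| * d + \sum_i #|[set x | private i x]|)%N.
  by rewrite big_split /= sum_cov sum_priv.
have ge2 : (2 * #|S| <= \sum_x (cov x + (cov x == 1)))%N.
  rewrite mulnC -sum_nat_const; apply: leq_sum => x _; exact: cov_ge.
have le_d : (\sum_i #|[set x | private i x]| <= d)%N.
  by rewrite -[X in (_ <= X)%N]card_ord -sum1_card; apply: leq_sum.
have sum1d : (\sum_(i < d) 1 = d)%N by rewrite sum1_card card_ord.
have sum2n : (\sum_(x : S) 2 = 2 * #|S|)%N by rewrite sum_nat_const mulnC.
split=> [x | i].
  have := @eq_sum_pointwise S (fun=> 2%N) _ cov_ge _ x.
  rewrite sum2n sumD -extremal mulnDl mul1n leq_add2l => /(_ le_d) ->.
  exact: leq_addr.
have := @eq_sum_pointwise _ _ (fun=> 1%N) priv_le1 _ i.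
rewrite sum1d -(leq_add2l (#|supp v| * d)) -sumD.
rewrite -[X in (_ + X <= _)%N]mul1n -mulnDl extremal.
by move=> /(_ ge2)/eqP/cards1P[x /setP/(_ x)]; rewrite !inE eqxx; exists x.
Qed.

End Cover.

Lemma cover_le2 d (b : 'I_d -> permmod F S) x i j k :
  ((#|supp v| + 1) * d = 2 * #|S|)%N -> spanning_translates to v b ->
  i != j -> i != k -> j != k -> b i x != 0 -> b j x != 0 -> b k x = 0.
Proof.
move=> extremal spanb ij ik jk bi bj; apply/eqP; apply: contraT => bk.
have [/(_ x) + _] := extremal_cover spanb extremal; rewrite leqNgt => /negP[].
have <- : #|[set i; j; k]| = 3%N.
  by rewrite setUC cardsU1 cards2 !inE ij (eq_sym k i) (eq_sym k j) (negPf ik) (negPf jk).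
by apply: subset_leq_card; apply/subsetP => l; rewrite !inE => /orP[/orP[]|] /eqP->.
Qed.

(** * Exchanging a member of the family for another translate *)

Section Exchange.
Variables (d : nat) (b : 'I_d -> permmod F S).
Hypothesis spanb : spanning_translates to v b.
Hypothesis extremal : ((#|supp v| + 1) * d = 2 * #|S|)%N.

Lemma spanning_exchange g (c : 'I_d -> F) i :
  translate to v g = \sum_j c j *: b j -> c i != 0 ->
  spanning_translates to v (fun j => if j == i then translate to v g else b j).
Proof.
move=> defw ci; have [trb genb] := spanb; split=> [j | h].
  by case: eqP => _; [exists g | apply: trb].
have [c' ->] := genb h.
(* These coefficients come from solving [defw] for [b i] and substituting. *)
exists (fun j => if j == i then c' i / c i else c' j - c' i / c i * c j).
rewrite (bigD1 i) //= [RHS](bigD1 i) //= eqxx defw [in RHS](bigD1 i) //=.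
rewrite scalerDr scalerA divfK // -addrA; congr (_ + _).
rewrite scaler_sumr -big_split /=; apply: eq_bigr => j /negPf ->.
by rewrite scalerA -scalerDl addrC subrK.
Qed.

Section Combination.
Variables (g : G) (c : 'I_d -> F).
Hypothesis defw : translate to v g = \sum_j c j *: b j.
Let w := translate to v g.

(** After [w] replaces [b i], the point [y] is already covered by [b j] and [b k], and no third
    member may cover it. *)
Lemma combination_pair i j k y :
  c i != 0 -> i != j -> i != k -> j != k -> b j y != 0 -> b k y != 0 -> w y = 0.
Proof.
move=> ci ij ik jk bj bk; have spanb' := spanning_exchange defw ci.
have := @cover_le2 d _ y j k i extremal spanb' jk.
by rewrite !eqxx (eq_sym j i) (eq_sym k i) (negPf ij) (negPf ik); apply.
Qed.

Lemma combination_pairE i j y :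
  i != j -> b i y != 0 -> b j y != 0 -> w y = c i * b i y + c j * b j y.
Proof.
move=> ij bi bj; rewrite /w defw sum_scaleE (bigD1 i) //= (bigD1 j) 1?eq_sym //=.
rewrite big1 ?addr0 // => k /andP[ki kj].
by rewrite (cover_le2 extremal spanb ij _ _ bi bj) 1?eq_sym ?mulr0 // eq_sym.
Qed.

(** The point [z] is the private point of [b j] once [w] has replaced [b i]. There [w] vanishes
    although [c j * b j z] does not, so [b i] must cancel it; uniqueness is that of private
    points. *)
Lemma combination_meet i j : c i != 0 -> c j != 0 -> i != j ->
  exists2 z, [/\ b i z != 0, b j z != 0 & w z = 0] &
    forall y, b i y != 0 -> b j y != 0 -> w y = 0 -> y = z.
Proof.
move=> ci cj ij; have spanb' := spanning_exchange defw ci.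
have [_ /(_ j)[z pz]] := extremal_cover spanb' extremal.
have ji : j != i by rewrite eq_sym.
have [] := privateP _ _ _ pz; rewrite /= (negPf ji) => bj b0.
have w0 : w z = 0 by have := b0 i ij; rewrite eqxx.
exists z => [|y biy bjy wy].
  split=> //; apply/eqP => bi0; move: w0.
  rewrite /w defw sum_scaleE (bigD1 j) //= big1 => [|k kj].
    by rewrite addr0 => /eqP; rewrite mulf_eq0 (negPf cj) (negPf bj).
  have := b0 k kj; case: eqP => [-> | _ ->]; last by rewrite mulr0.
  by rewrite bi0 mulr0.
apply: (private_uniq spanb' _ pz); apply/privateP; rewrite /= (negPf ji).
split=> // k kj; case: eqP => [// | /eqP ki].
by apply: (cover_le2 extremal spanb ij _ _ biy bjy); rewrite eq_sym.
Qed.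

(** If [b j] were nonzero at [y], exchanging [b i'] would force [w y = 0], while [w y = c i * b i y]
    because [c j = 0]. *)
Lemma combination_closed i i' j y : c i != 0 -> c i' != 0 -> i != i' ->
  c j = 0 -> b i y != 0 -> b j y = 0.
Proof.
move=> ci ci' ii' cj bi; apply/eqP; apply: contraT => bj.
have ij : i != j by apply: contraNneq ci => ->; rewrite cj.
have i'j : i' != j by apply: contraNneq ci' => ->; rewrite cj.
have i'i : i' != i by rewrite eq_sym.
have := combination_pair ci' i'i i'j ij bi bj.
rewrite (combination_pairE ij bi bj) cj mul0r addr0 => /eqP.
by rewrite mulf_eq0 (negPf ci) (negPf bi).
Qed.

End Combination.

(** Call a set closed if it contains the support of every translate whose support it meets. Lying in
    the same closed sets is a congruence, and it relates two distinct points of [supp v]; so it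
    relates all points. *)
Lemma translates_connected (U : {set S}) x0 : x0 \in U ->
  (forall h x y, translate to v h x != 0 -> translate to v h y != 0 ->
     x \in U -> y \in U) -> forall x, x \in U.
Proof.
move=> Ux0 closedU.
pose closed (V : {set S}) := forall h x y, translate to v h x != 0 ->
  translate to v h y != 0 -> x \in V -> y \in V.
pose E x y := forall V, closed V -> (x \in V) = (y \in V).
have [||||allE|eqE] := @primitive_congruence G S to primS E.
- by [].
- by move=> x y xy V cV; rewrite xy.
- by move=> x y z xy yz V cV; rewrite xy ?yz.
- move=> x y g xy V cV; pose V' := [set z | to z g \in V].
  have := xy V'; rewrite !inE; apply=> h z z' hz hz'; rewrite !inE.
  by apply: (cV (h * g)%g); rewrite -translateM translateE right_actK.
- by move=> x; rewrite -(allE x0 x).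
have [x [y [vx vy xy]]] : exists x y, [/\ v x != 0, v y != 0 & x != y].
  have /card_gt1P[x [y [vx vy xy]]] := supp_gt1.
  by exists x, y; move: vx vy; rewrite !inE.
case/eqP: xy; apply: eqE => V cV.
have t1 z : translate to v 1%g z = v z by rewrite translateE invg1 right_act1.
by apply/idP/idP; apply: (cV 1%g); rewrite !t1.
Qed.

(** Let [U] be the union of the supports of the [b k] with [c k != 0]. If a translate meets [U] and
    involves some [b l] with [c l = 0], then [combination_meet] for that translate gives a point
    common to [b l] and a used member, against [combination_closed]. So [U] is closed, hence equal
    to [S], and contains the private point of each [b j]. *)
Lemma combination_full g (c : 'I_d -> F) i i' :
  translate to v g = \sum_j c j *: b j ->
  c i != 0 -> c i' != 0 -> i != i' -> forall j, c j != 0.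
Proof.
move=> defw ci ci' ii' j.
have other k : c k != 0 -> exists2 l, c l != 0 & k != l.
  by move=> ck; have [-> | ki] := eqVneq k i; [exists i' | exists i].
have [_ /(_ i)[x0 /privateP[bx0 _]]] := extremal_cover spanb extremal.
pose U := [set x | [exists k, (c k != 0) && (b k x != 0)]].
have UP x : reflect (exists2 k, c k != 0 & b k x != 0) (x \in U).
  by rewrite inE; apply: (iffP existsP) => [[k /andP[]] | [k ck bk]]; exists k; rewrite ?ck.
have nz c' x : (\sum_k c' k *: b k) x != 0 -> exists2 k, c' k != 0 & b k x != 0.
  rewrite sum_scaleE => nz; apply/exists_inP; apply: contraNT nz.
  rewrite negb_exists_in => /forall_inP h; apply/eqP/big1 => k _.
  have [-> | ck] := eqVneq (c' k) 0; first by rewrite mul0r.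
  by have := h k ck; rewrite negbK => /eqP->; rewrite mulr0.
have allU : forall x, x \in U.
  apply: (@translates_connected U x0); first by apply/UP; exists i.
  move=> h x y; have [_ /(_ h)[c' defh]] := spanb; rewrite defh.
  move=> /nz[k c'k bk] /nz[l c'l bl] /UP[m cm bm].
  have ck : c k != 0.
    apply: contraNneq bk => ck; have [m' cm' mm'] := other m cm.
    by rewrite (combination_closed defw cm cm' mm' ck bm).
  apply/UP; exists l => //; apply: contraT; rewrite negbK => /eqP cl.
  have kl : k != l by apply: contraNneq ck => ->; rewrite cl.
  have [z [bkz blz _] _] := combination_meet defh c'k c'l kl.
  have [m' cm' km'] := other k ck.
  by move: blz; rewrite (combination_closed defw ck cm' km' cl bkz) eqxx.
have [_ /(_ j)[x /privateP[bx b0]]] := extremal_cover spanb extremal.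
have /UP[k ck] := allU x; have [<- // | /b0->] := eqVneq k j.
by rewrite eqxx.
Qed.

(** A translate that is nonzero at the private point [x] of [b i] and has another support than [b i]
    involves a second member. If there were none, take [y != x] in the support of [b i] and [b j]
    with [j != i] nonzero at [y]: moving [y] to [x] shows that [b i] and [b j] have equal supports,
    yet [b j] vanishes at [x]. *)
Lemma exists_full_combination (i : 'I_d) :
  exists g c, translate to v g = \sum_j c j *: b j /\ forall j, c j != 0.
Proof.
have [cov2 priv] := extremal_cover spanb extremal.
have [x px] := priv i; have [bx b0] := privateP _ _ _ px.
have [trb genb] := spanb; have [a defa] := trb i.
suffices [g gx ng] : exists2 g, translate to v g x != 0 &
    supp (translate to v g) != supp (b i).
  have [c defw] := genb g; exists g, c; split=> //.
  have ci : c i != 0.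
    by apply: contraNneq gx => ci; rewrite defw (private_coord c px) ci mul0r.
  have [k /andP[ki ck] | c0] := pickP (fun k => (k != i) && (c k != 0)).
    by apply: (combination_full defw ci ck); rewrite eq_sym.
  case/eqP: ng; apply/setP => y; rewrite !inE defw sum_scaleE (bigD1 i) //=.
  rewrite big1 ?addr0 ?mulf_eq0 ?(negPf ci) // => k ki.
  by have := c0 k; rewrite ki => /negbFE/eqP->; rewrite mul0r.
apply: contrapT => none.
have all_eq g : translate to v g x != 0 -> supp (translate to v g) = supp (b i).
  by move=> gx; apply/eqP; apply: contraT => ng; case: none; exists g.
have [y [biy yx]] : exists y, b i y != 0 /\ y != x.
  have : (0 < #|supp (b i) :\ x|)%N.
    by move: supp_gt1; rewrite -(card_supp_translate a) -defa (cardsD1 x) inE bx.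
  by case/card_gt0P=> y; rewrite !inE => /andP[yx biy]; exists y.
have [j ji bjy] : exists2 j, j != i & b j y != 0.
  apply/exists_inP; apply: contraNT yx; rewrite negb_exists_in => /forall_inP h.
  apply/eqP/(private_uniq spanb _ px)/privateP; split=> // j ji.
  by apply/eqP/negbNE/h.
have [e defe] := trb j; have [[_ tr] _] := primS; have [k xk] := tr x y.
have shift h : translate to v (h * k^-1)%g x = translate to v h y.
  by rewrite -translateM translateE invgK xk.
have eq_k : supp (translate to v (e * k^-1)%g) = supp (translate to v (a * k^-1)%g).
  by rewrite !all_eq // shift -?defa -?defe.
have : supp (b j) = supp (b i).
  rewrite defa defe -(mulgKV k e) -(mulgKV k a) -!(translateM _ k).
  by rewrite !(supp_translate _ (translate to v _) k) eq_k.
by move/setP/(_ x); rewrite !inE bx b0 // eqxx.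
Qed.

End Exchange.

(* The case J = option 'I_d arises with u (Some i) = c_i b_i and u None = - w,
   where w = sum_i c_i b_i. *)
Record double_cover (J : finType) (u : J -> permmod F S) : Prop := DoubleCover {
  cover_translate : forall g, exists k a, a != 0 /\ translate to v g = a *: u k;
  cover_member : forall k, exists g a, a != 0 /\ translate to v g = a *: u k;
  cover_meet : forall k l, k != l ->
    exists x, forall y, (u k y != 0) && (u l y != 0) = (y == x);
  cover_two : forall x, exists k l, k != l /\
    forall m, (u m x != 0) = (m == k) || (m == l);
  cover_opp : forall k l x, k != l -> u k x != 0 -> u l x != 0 -> u k x = - u l x }.

(** As [d > 2], any two indices leave a third one to exchange, so by [combination_pair] every full
    combination vanishes where two of the [b i] meet. Hence the supports of [c i *: b i] and
    [c j *: b j] meet in one point, where the values are opposite, and [w] is supported on the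
    private points. *)
Lemma exists_double_cover d :
  ((#|supp v| + 1) * d = 2 * #|S|)%N -> (2 < d)%N ->
  (exists b : 'I_d -> permmod F S, spanning_translates to v b) ->
  exists u : option 'I_d -> permmod F S, double_cover u.
Proof.
move=> extremal d_gt2 [b spanb]; have [cov2 priv] := extremal_cover spanb extremal.
pose i0 : 'I_d := Ordinal (ltnW (ltnW d_gt2)).
have third (i j : 'I_d) : exists k, (k != i) && (k != j).
  apply/existsP; apply: contraT; rewrite negb_exists => /forallP all_ij.
  move: (d_gt2); rewrite ltnNge -[d in (d <= _)%N]card_ord -cardsT => /negP[].
  apply: leq_trans (_ : #|[set i; j]| <= 2)%N; last by rewrite cards2; case: (_ != _).
  apply: subset_leq_card; apply/subsetP => k _; rewrite !inE.
  by have := all_ij k; rewrite negb_and !negbK.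
have pair0 g c i j y : translate to v g = \sum_k c k *: b k -> (forall k, c k != 0) ->
    i != j -> b i y != 0 -> b j y != 0 -> translate to v g y = 0.
  move=> defw c0 ij bi bj; have [k /andP[ki kj]] := third i j.
  exact: (combination_pair spanb extremal defw (c0 k) ki kj ij bi bj).
have [g [c [defw c0]]] := exists_full_combination spanb extremal i0.
have meet i j : i != j -> exists2 z, b i z != 0 /\ b j z != 0 &
    forall y, b i y != 0 -> b j y != 0 -> y = z.
  move=> ij; have [z [bi bj _] uz] := combination_meet spanb extremal defw (c0 i) (c0 j) ij.
  by exists z => // y biy bjy; apply: uz => //; apply: pair0 defw c0 ij biy bjy.
have bU i x : b i x != 0 -> private b i x \/ exists2 j, j != i & b j x != 0.
  move=> bi; have [p | np] := boolP (private b i x); [by left | right].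
  move: np; rewrite /private bi /= negb_forall => /existsP[j].
  by rewrite negb_imply => /andP[ji bj]; exists j.
have bC i j k x : i != j -> b i x != 0 -> b j x != 0 -> (b k x != 0) = (k == i) || (k == j).
  move=> ij bi bj; have [-> | ki] := eqVneq k i; first by rewrite bi.
  have [-> | kj] := eqVneq k j; first by rewrite bj.
  by rewrite (cover_le2 extremal spanb ij _ _ bi bj) ?eqxx // eq_sym.
pose w := translate to v g.
pose u k := if k is Some i then c i *: b i else - w.
have uS i x : u (Some i) x = c i * b i x by rewrite /u ffunE.
have uN x : u None x = - w x by rewrite /u ffunE.
have uS0 i x : (u (Some i) x != 0) = (b i x != 0).
  by rewrite uS mulf_eq0 (negPf (c0 i)).
have uN0 x : (u None x != 0) = (w x != 0) by rewrite uN oppr_eq0.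
have w_priv i x : private b i x -> w x = c i * b i x.
  by move=> p; rewrite /w defw; apply: private_coord.
exists u; split.
- move=> h; have [_ /(_ h)[c' defh]] := spanb.
  have [i ci] : exists i, c' i != 0.
    apply/existsP; apply: contraT; rewrite negb_exists => /forallP c'0.
    have /card_gt0P[x] : (0 < #|supp (translate to v h)|)%N.
      by rewrite card_supp_translate ltnW.
    rewrite inE defh sum_scaleE big1 ?eqxx // => i _.
    by have := c'0 i; rewrite negbK => /eqP->; rewrite mul0r.
  have [j /andP[ji cj] | c'0] := pickP (fun j => (j != i) && (c' j != 0)).
    have ij : i != j by rewrite eq_sym.
    have full := combination_full spanb extremal defh ci cj ij.
    (* Any other full combination is a multiple of [w]: both vanish at the common point of [b i] and
       [b k], which fixes the ratio of their coefficients at [i] and [k]. *)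
    exists None, (- (c' i / c i)); split.
      by rewrite oppr_eq0 mulf_neq0 ?invr_eq0.
    rewrite /= scalerN scaleNr opprK /w defh defw scaler_sumr.
    apply: eq_bigr => k _; rewrite scalerA; congr (_ *: _).
    have [-> | ki] := eqVneq k i; first by rewrite divfK.
    have ik : i != k by rewrite eq_sym.
    have [z [bi bk] _] := meet i k ik.
    have := pair0 g c i k z defw c0 ik bi bk.
    have := pair0 h c' i k z defh full ik bi bk.
    rewrite (combination_pairE spanb extremal defw ik bi bk).
    rewrite (combination_pairE spanb extremal defh ik bi bk).
    move/eqP; rewrite addr_eq0 => /eqP e1; move/eqP; rewrite addr_eq0 => /eqP e2.
    apply: (mulIf bk); rewrite -mulrA; apply: (can_inj (@opprK F)).
    by rewrite -e1 -mulrN -e2 mulrA divfK.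
  exists (Some i), (c' i / c i); split; first by rewrite mulf_neq0 ?invr_eq0.
  rewrite defh (bigD1 i) //= big1 ?addr0 => [|j ji]; first by rewrite scalerA divfK.
  by have := c'0 j; rewrite ji => /negbFE/eqP->; rewrite scale0r.
- case=> [i|]; last by exists g, (- 1); rewrite oppr_eq0 oner_eq0 scaleN1r opprK.
  have [h bh] := spanb.1 i; exists h, (c i)^-1.
  by rewrite invr_eq0 /= scalerA mulVf // scale1r bh.
- have meetN i : exists x, forall y, (u None y != 0) && (u (Some i) y != 0) = (y == x).
    have [x px] := priv i; exists x => y; rewrite uS0 uN0.
    apply/andP/eqP => [[wy biy] | ->].
      have [py | [j ji bj]] := bU i y biy; first exact: (private_uniq spanb py px).
      by case/eqP: wy; apply: pair0 defw c0 ji bj biy.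
    have [bi _] := privateP _ _ _ px; split=> //.
    by rewrite (w_priv _ _ px) mulf_neq0.
  case=> [i|] [j|] ij; last by rewrite eqxx in ij.
  - have /meet[z [bi bj] uz] : i != j by apply: contraNneq ij => ->.
    exists z => y; rewrite !uS0; apply/andP/eqP => [[biy bjy] | -> //]; exact: uz.
  - by have [x xP] := meetN i; exists x => y; rewrite andbC.
  exact: meetN.
- move=> x; have [i bi] := covered spanb x.
  have [px | [j ji bj]] := bU i x bi.
    exists None, (Some i); split=> // -[m|].
      rewrite uS0; have [-> | mi] := eqVneq m i; first by rewrite bi eqxx.
      have [_ /(_ m mi)->] := privateP _ _ _ px; rewrite eqxx /=.
      by apply/esym/eqP => -[/eqP]; rewrite (negPf mi).
    by rewrite uN0 (w_priv _ _ px) mulf_neq0.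
  exists (Some i), (Some j); have ij : i != j by rewrite eq_sym.
  split; first by apply: contraNneq ij => -[->].
  case=> [m|]; first by rewrite uS0 (bC i j m).
  by rewrite uN0 /w (pair0 g c i j x) ?eqxx.
have oppN i x : u None x != 0 -> u (Some i) x != 0 -> u None x = - u (Some i) x.
  rewrite uS0 uN0 uS uN => wx bi; have [px | [j ji bj]] := bU i x bi.
    by rewrite (w_priv _ _ px).
  by case/eqP: wx; apply: pair0 defw c0 ji bj bi.
case=> [i|] [j|] x ij; last by rewrite eqxx in ij.
- rewrite !uS0 !uS => bi bj; have nij : i != j by apply: contraNneq ij => ->.
  apply/eqP; rewrite -addr_eq0 -(combination_pairE spanb extremal defw nij bi bj).
  by apply/eqP; apply: pair0 defw c0 nij bi bj.
- by move=> ui uj; rewrite (oppN i x) // opprK.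
exact: oppN.
Qed.

End Equality.

(** * Groups acting primitively on pairs *)

Section PairAction.
Variables (G : groupType) (S : finType) (to : right_action G S).
Variables (J : finType) (D : J -> {set S}).
Hypothesis primS : primitive_gset to.
Hypothesis J_gt3 : (3 < #|J|)%N.
Hypothesis D_translate : forall k g, exists l, D l = set_translate to (D k) g.
Hypothesis D_meet : forall k l, k != l -> exists x, D k :&: D l = [set x].
Hypothesis D_two : forall x, exists k l, k != l /\
  forall m, (x \in D m) = (m == k) || (m == l).

Lemma two_members k l m x :
  k != l -> x \in D k -> x \in D l -> (x \in D m) = (m == k) || (m == l).
Proof.
have [a [b [ab xD]]] := D_two x; rewrite !xD.
move=> kl /orP[]/eqP ek /orP[]/eqP el; move: kl; rewrite ek el ?eqxx // => _; exact: orbC.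
Qed.

Lemma avoid (A : {set J}) : (#|A| <= 3)%N -> exists k, k \notin A.
Proof.
move=> A3; apply/existsP; apply: contraT; rewrite negb_exists => /forallP allA.
move: J_gt3; rewrite ltnNge => /negP[]; apply: leq_trans A3.
rewrite -cardsT; apply: subset_leq_card; apply/subsetP => k _.
by have := allA k; rewrite negbK.
Qed.

Lemma avoid3 (a b c : J) : exists k, [/\ k != a, k != b & k != c].
Proof.
have [|k] := @avoid [set a; b; c].
  rewrite setUC; apply: leq_trans (leq_card_setU _ _) _.
  by rewrite cards1 cards2; case: (_ != _).
by rewrite !inE !negb_or => /andP[/andP[ka kb] kc]; exists k.
Qed.

(** A third member meets [D k] in a point, which would lie in three members if [D k = D l]. *)
Lemma D_inj : injective D.
Proof.
move=> k l eqD; apply/eqP; apply: contraT => kl.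
have [m [mk ml _]] := avoid3 k l l.
have [x /setP/(_ x)] := D_meet mk; rewrite !inE eqxx => /andP[xm xk].
have xl : x \in D l by rewrite -eqD.
by move: xm; rewrite (two_members m kl xk xl) (negPf mk) (negPf ml).
Qed.

(* The default value of [odflt] is never used, see [idx_actE]. *)
Definition idx_act (k : J) (g : G) : J :=
  odflt k [pick l | D l == set_translate to (D k) g].

Lemma idx_actE k g : D (idx_act k g) = set_translate to (D k) g.
Proof.
rewrite /idx_act; case: pickP => [l /eqP // | no].
by have [l eqD] := D_translate k g; have := no l; rewrite eqD eqxx.
Qed.

Lemma mem_idx_act k g x : (to x g \in D (idx_act k g)) = (x \in D k).
Proof. by rewrite idx_actE /set_translate mem_imset //; apply: right_act_inj. Qed.

Lemma idx_act1 k : idx_act k 1%g = k.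
Proof. by apply: D_inj; rewrite idx_actE set_translate1. Qed.

Lemma idx_actM k g h : idx_act k (g * h)%g = idx_act (idx_act k g) h.
Proof. by apply: D_inj; rewrite !idx_actE set_translateM. Qed.

Lemma idx_actK g : cancel (idx_act^~ g) (idx_act^~ g^-1%g).
Proof. by move=> k; rewrite -idx_actM mulgV idx_act1. Qed.

Lemma idx_act_inj g : injective (idx_act^~ g).
Proof. exact: can_inj (idx_actK g). Qed.

Lemma meet_point k l : k != l -> exists x, x \in D k /\ x \in D l.
Proof.
move=> kl; have [x /setP/(_ x)] := D_meet kl.
by rewrite !inE eqxx => /andP[xk xl]; exists x.
Qed.

Lemma pair_transport a b c e g x y :
  a != b -> c != e -> x \in D a -> x \in D b -> y \in D c -> y \in D e ->
  to x g = y ->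
  (idx_act a g = c /\ idx_act b g = e) \/ (idx_act a g = e /\ idx_act b g = c).
Proof.
move=> ab ce xa xb yc ye xy.
have := mem_idx_act a g x; rewrite xy xa (two_members _ ce yc ye).
have := mem_idx_act b g x; rewrite xy xb (two_members _ ce yc ye).
have nab : idx_act a g != idx_act b g by rewrite (inj_eq (@idx_act_inj g)).
by case/orP=> /eqP eb /orP[] /eqP ea; move: nab; rewrite ea eb ?eqxx // => _; [right | left].
Qed.

Lemma pair_homogeneous a b c e : a != b -> c != e -> exists g,
  (idx_act a g = c /\ idx_act b g = e) \/ (idx_act a g = e /\ idx_act b g = c).
Proof.
move=> ab ce; have [x [xa xb]] := meet_point ab; have [y [yc ye]] := meet_point ce.
have [[_ tr] _] := primS; have [g xy] := tr x y.
by exists g; apply: pair_transport xy.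
Qed.

(** By primitivity the stabilizer of [a] otherwise carries [x] to every point, but it cannot move
    [x] out of [D a]. *)
Lemma stabilizer_le a x : x \in D a ->
  (forall g, to x g = x -> idx_act a g = a) ->
  forall g, idx_act a g = a -> to x g = x.
Proof.
move=> xa Pa; have := @primitive_overgroup _ _ _ primS (fun g => idx_act a g = a) x.
case=> //.
- by move=> g h ga ha; rewrite idx_actM ga.
- by move=> g ga; rewrite -{1}ga idx_actK.
move=> tr; have [b [ba _ _]] := avoid3 a a a; have [c [ca cb _]] := avoid3 a b b.
have [y [yb yc]] : exists y, y \in D b /\ y \in D c by apply: meet_point; rewrite eq_sym.
have [g ga xy] := tr y; have := mem_idx_act a g x; rewrite ga xy xa.
have bc : b != c by rewrite eq_sym.
by rewrite (two_members a bc yb yc) ![a == _]eq_sym (negPf ba) (negPf ca).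
Qed.

(* If no pair is swapped, then the stabilizer of x fixes a, so by primitivity it is
   the stabilizer of a, which thus fixes every index. *)
Lemma pair_swap a b : a != b -> exists g, idx_act a g = b /\ idx_act b g = a.
Proof.
move=> ab; apply: contrapT => noswap0.
have noswap c e : c != e -> ~ exists g, idx_act c g = e /\ idx_act e g = c.
  move=> ce [h [hc he]]; apply: noswap0; have [g gab] := pair_homogeneous ab ce.
  exists (g * h * g^-1)%g; rewrite !idx_actM.
  by case: gab => -[ga gb]; rewrite ga gb hc he -ga -gb !idx_actK.
have fix_all c e g : idx_act c g = c -> idx_act e g = e.
  move=> gc; have [-> // | ec] := eqVneq e c; have ce : c != e by rewrite eq_sym.
  have [x [xc xe]] := meet_point ce.
  have stab h : to x h = x -> idx_act c h = c.
    move=> xh; have := @pair_transport c e c e h x x ce ce xc xe xc xe xh.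
    by case=> -[hc he] //; case: (noswap _ _ ce); exists h.
  have xg := stabilizer_le xc stab gc.
  have := @pair_transport c e c e g x x ce ce xc xe xc xe xg.
  by case=> -[hc he] //; case: (noswap _ _ ce); exists g.
have [c [ca cb _]] := avoid3 a b b; have [e [ea eb ec]] := avoid3 a b c.
(* By [fix_all] an element that sends the pair of [a] and [b] to that of [a] and [z] cannot fix [a].
   With two targets [c] and [e], the quotient [g^-1 * h] fixes [a] but sends [c] to [e]. *)
have move_to z : z != a -> z != b -> exists g, idx_act a g = z /\ idx_act b g = a.
  move=> za zb; have az : a != z by rewrite eq_sym.
  have [g [[ga gz] | ?]] := pair_homogeneous ab az; last by exists g.
  by move: zb; rewrite -gz (fix_all a b g ga) eqxx.
have [g [ga gb]] := move_to c ca cb; have [h [ha hb]] := move_to e ea eb.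
have fix_a : idx_act a (g^-1 * h)%g = a by rewrite idx_actM -{1}gb idx_actK.
have := fix_all a c _ fix_a; rewrite idx_actM -{1}ga idx_actK ha => /eqP.
by rewrite (negPf ec).
Qed.

Lemma pair_transitive a b c e : a != b -> c != e ->
  exists g, idx_act a g = c /\ idx_act b g = e.
Proof.
move=> ab ce; have [g [gab | [ga gb]]] := pair_homogeneous ab ce; first by exists g.
have [h [hc he]] := pair_swap ce.
by exists (g * h)%g; rewrite !idx_actM ga gb.
Qed.

Definition idx_perm g : {perm J} := perm (@idx_act_inj g).

(** [G] may be infinite; its image in the permutations of [J] is the finite group to which
    [pair_fixpoint] applies. *)
Lemma idx_perm_group_set : group_set [set s | `[< exists g, s = idx_perm g >]].
Proof.
apply/group_setP; split=> [|s1 s2]; rewrite !inE.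
  by apply/asboolP; exists 1%g; apply/permP => k; rewrite perm1 permE idx_act1.
move=> /asboolP[g ->] /asboolP[h ->]; apply/asboolP; exists (g * h)%g.
by apply/permP => k; rewrite permM !permE idx_actM.
Qed.

(** Let [x] be the common point of [D i] and [D j]. The index [c] from [pair_fixpoint] is fixed by
    the stabilizer of [x], and it differs from [i] and [j], which some such element swaps. By
    primitivity the stabilizer of [c] either moves [x] into [D c], which does not contain it, or
    fixes [x], although it moves [i] to a fourth index. *)
Lemma no_reversible_tournament (r : rel J) :
  (forall k l, k != l -> r l k = ~~ r k l) ->
  (forall g, (forall k l, k != l -> r (idx_act k g) (idx_act l g) = r k l) \/
             (forall k l, k != l -> r (idx_act k g) (idx_act l g) = r l k)) ->
  False.
Proof.
move=> r_tour r_act; pose A := Group idx_perm_group_set.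
have AP s : s \in A -> exists g, s = idx_perm g by rewrite inE => /asboolP.
have inA g : idx_perm g \in A by rewrite inE; apply/asboolP; exists g.
have /card_gt0P[i _] : (0 < #|J|)%N by apply: leq_ltn_trans J_gt3.
have [j [ji _ _]] := avoid3 i i i; have ij : i != j by rewrite eq_sym.
have A_r s : s \in A -> preserves r s || reverses r s.
  move=> /AP[g ->]; have [pg | rg] := r_act g; apply/orP; [left | right].
    by apply/preservesP => k l kl; rewrite !permE pg.
  by apply/reversesP => k l kl; rewrite !permE rg.
have A_stable (s : {perm J}) k : s \in A -> k \in [set: J] -> s k \in [set: J] by [].
have A_2trans a b c e : a \in [set: J] -> b \in [set: J] -> c \in [set: J] ->
    e \in [set: J] -> a != b -> c != e -> exists s, [/\ s \in A, s a = c & s b = e].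
  move=> _ _ _ _ ab ce; have [g [ga gb]] := pair_transitive ab ce.
  by exists (idx_perm g); rewrite !permE.
have J_gt2 : (2 < #|[set: J]|)%N by rewrite cardsT ltnW.
have [c _ fixc] :=
  pair_fixpoint r_tour A_r A_stable A_2trans J_gt2 (in_setT i) (in_setT j) ij.
have fix_c g : (idx_act i g = i /\ idx_act j g = j) \/ (idx_act i g = j /\ idx_act j g = i) ->
    idx_act c g = c.
  move=> gij; have := fixc _ (inA g); rewrite !permE; apply.
  by case: gij => -[-> ->] //; rewrite setUC.
have [x [xi xj]] := meet_point ij.
have [h [hi hj]] := pair_swap ij; have hc : idx_act c h = c by apply: fix_c; right.
have ci : c != i by apply: contraNneq ij => eci; rewrite -[X in X == _]eci -hc eci hi.
have cj : c != j by apply: contraNneq ij => ecj; rewrite -[X in _ == X]ecj -hc ecj hj.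
have := @primitive_overgroup _ _ _ primS (fun g => idx_act c g = c) x.
case.
- by move=> g1 g2 e1 e2; rewrite idx_actM e1.
- by move=> g ga; rewrite -{1}ga idx_actK.
- by move=> g xg; apply: fix_c; apply: pair_transport xg.
- move=> tr; have jc : j != c by rewrite eq_sym.
  have [y [yj yc]] := meet_point jc.
  have [g gc xy] := tr y; have := mem_idx_act c g x; rewrite gc xy yc.
  by rewrite (two_members c ij xi xj) (negPf ci) (negPf cj).
move=> stab_c; have [e [ei ej ec]] := avoid3 i j c; have ce : c != e by rewrite eq_sym.
have [g [gc gi]] := pair_transitive ci ce.
have := @pair_transport i j i j g x x ij ij xi xj xi xj (stab_c g gc).
by rewrite gi; case=> -[/eqP]; rewrite ?(negPf ei) ?(negPf ej).
Qed.

End PairAction.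

(** * Signs and the characteristic *)

Section Signs.
Variables (G : groupType) (S : finType) (to : right_action G S).
Variables (F : fieldType) (v : permmod F S) (J : finType) (u : J -> permmod F S).
Hypothesis primS : primitive_gset to.
Hypothesis J_gt3 : (3 < #|J|)%N.
Hypothesis cov : double_cover to v u.

Let D k := supp (u k).

Lemma supp_scale a (f : permmod F S) : a != 0 -> supp (a *: f) = supp f.
Proof. by move=> a0; apply/setP => x; rewrite !inE ffunE mulf_eq0 (negPf a0). Qed.

Lemma cover_supp_translate k g : exists l, D l = set_translate to (D k) g.
Proof.
have [h [a [a0 eq_h]]] := cover_member cov k.
have [l [a' [a'0 eq_hg]]] := cover_translate cov (h * g)%g.
exists l; rewrite /D -(supp_scale (u l) a'0) -(supp_scale (u k) a0) -eq_h -eq_hg.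
by rewrite !supp_translate set_translateM.
Qed.

Lemma cover_supp_meet k l : k != l -> exists x, D k :&: D l = [set x].
Proof.
move=> kl; have [x xP] := cover_meet cov kl.
by exists x; apply/setP => y; rewrite !inE.
Qed.

Lemma cover_supp_two x :
  exists k l, k != l /\ forall m, (x \in D m) = (m == k) || (m == l).
Proof.
have [k [l [kl xP]]] := cover_two cov x.
by exists k, l; split=> // m; rewrite inE.
Qed.

Let inj_D := D_inj J_gt3 cover_supp_meet cover_supp_two.
Let act := idx_act to D.
Let act_mem k g x : (to x g \in D (act k g)) = (x \in D k).
Proof. exact: mem_idx_act cover_supp_translate k g x. Qed.
Let actK g : cancel (act^~ g) (act^~ g^-1%g).
Proof. exact: idx_actK J_gt3 cover_supp_translate cover_supp_meet cover_supp_two g. Qed.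
Let actM k g h : act k (g * h)%g = act (act k g) h.
Proof. exact: idx_actM J_gt3 cover_supp_translate cover_supp_meet cover_supp_two k g h. Qed.
Let transport :=
  pair_transport J_gt3 cover_supp_translate cover_supp_meet cover_supp_two.
Let transitive2 :=
  pair_transitive primS J_gt3 cover_supp_translate cover_supp_meet cover_supp_two.
Let point := meet_point cover_supp_meet.

Lemma supp_neq0 k x : x \in D k -> u k x != 0. Proof. by rewrite inE. Qed.

Lemma meet_uniq k l x y : k != l -> x \in D k -> x \in D l ->
  y \in D k -> y \in D l -> x = y.
Proof.
move=> kl xk xl yk yl; have [z eqI] := cover_supp_meet kl.
have in_z w : w \in D k -> w \in D l -> w = z.
  by move=> wk wl; apply/set1P; rewrite -eqI inE wk.
by rewrite (in_z x) // (in_z y).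
Qed.

Lemma other_member k x : x \in D k -> exists2 l, k != l & x \in D l.
Proof.
have [a [b [ab xP]]] := cover_supp_two x; rewrite xP.
case/orP=> /eqP->; [exists b | exists a]; rewrite ?xP ?eqxx ?orbT // eq_sym.
by [].
Qed.

(** Equivalently, [g] carries [u k] to [m *: u (act k g)], with one [m] for all [k]. *)
Definition multiplier g m := forall k x, u k x = m * u (act k g) (to x g).

(** Each [k] has its own scalar. At the common point of two members the values are opposite both
    before and after applying [g], so the two scalars agree. *)
Lemma exists_multiplier g : exists2 m, m != 0 & multiplier g m.
Proof.
have scal k : exists2 m, m != 0 & forall x, u k x = m * u (act k g) (to x g).
  have [h [a [a0 eq_h]]] := cover_member cov k.
  have [l [a' [a'0 eq_hg]]] := cover_translate cov (h * g)%g.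
  have -> : act k g = l.
    apply: inj_D; rewrite (idx_actE cover_supp_translate) /D.
    rewrite -(supp_scale (u l) a'0) -(supp_scale (u k) a0) -eq_h -eq_hg.
    by rewrite !supp_translate set_translateM.
  exists (a^-1 * a') => [|x]; first by rewrite mulf_neq0 ?invr_eq0.
  have eq_x : a * u k x = a' * u l (to x g).
    have := congr1 (fun f : permmod F S => f (to x g)) eq_hg.
    by rewrite -translateM translateE right_actK eq_h !ffunE.
  by rewrite -mulrA -eq_x mulKf.
have /card_gt0P[k0 _] : (0 < #|J|)%N by apply: leq_ltn_trans J_gt3.
have [m m0 defm] := scal k0; exists m => // k x.
have [-> // | kk0] := eqVneq k k0; have [m' m'0 defm'] := scal k.
suffices -> : m = m' by [].
have [y [yk yk0]] := point kk0.
have nact : act k g != act k0 g by rewrite (inj_eq (can_inj (actK g))).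
have := cover_opp cov kk0 (supp_neq0 yk) (supp_neq0 yk0).
rewrite defm defm' (cover_opp cov nact) ?supp_neq0 ?act_mem // mulrN => /oppr_inj.
by move/mulIf => -> //; rewrite supp_neq0 ?act_mem.
Qed.

Lemma multiplierM g h m n :
  multiplier g m -> multiplier h n -> multiplier (g * h)%g (m * n).
Proof. by move=> gm hn k x; rewrite gm hn actM right_actM mulrA. Qed.

Lemma multiplierV g m : m != 0 -> multiplier g m -> multiplier g^-1%g m^-1.
Proof.
move=> m0 gm k x; rewrite [in RHS]gm right_actVK.
by have := actK g^-1%g k; rewrite /= invgK => ->; rewrite mulKf.
Qed.

(* The elements with m^2 = 1 contain the stabilizer of a point x (compare u_a and
   u_b at x, where u_a = - u_b) and are normal, so by primitivity they are all of G
   or fix every point. *)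
Lemma multiplier_sqr1 g : exists2 m, m ^+ 2 = 1 & multiplier g m.
Proof.
pose P g := exists2 m, m ^+ 2 = 1 & multiplier g m.
have /card_gt0P[a _] : (0 < #|J|)%N by apply: leq_ltn_trans J_gt3.
have [b [ba _ _]] := avoid3 J_gt3 a a a; have ab : a != b by rewrite eq_sym.
have [x [xa xb]] := point ab.
have PM g1 g2 : P g1 -> P g2 -> P (g1 * g2)%g.
  move=> [m1 e1 h1] [m2 e2 h2]; exists (m1 * m2); last exact: multiplierM.
  by rewrite exprMn e1 e2 mulr1.
have sqr1_neq0 (m : F) : m ^+ 2 = 1 -> m != 0.
  by move=> e; apply: contra_eqN e => /eqP->; rewrite expr2 mul0r eq_sym oner_eq0.
have PV g1 : P g1 -> P g1^-1%g.
  move=> [m e h]; exists m^-1; last by apply: multiplierV (sqr1_neq0 m e) h.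
  by rewrite exprVn e invr1.
have stabP g1 : to x g1 = x -> P g1.
  move=> xg; have [m m0 gm] := exists_multiplier g1; exists m => //.
  have uax := supp_neq0 xa; have ubx := supp_neq0 xb.
  have := gm a x; rewrite xg.
  case: (@transport a b a b g1 x x ab ab xa xb xa xb xg) => -[ga _]; rewrite /act ga.
    by rewrite -{1}[u a x]mul1r => /(mulIf uax)<-; rewrite expr1n.
  rewrite (cover_opp cov ab uax ubx) -mulN1r => /(mulIf ubx)<-.
  by rewrite sqrrN expr1n.
have [tr | stab] := primitive_overgroup primS PM PV stabP.
  have [h Ph xh] := tr (to x g).
  have : P (g * h^-1)%g by apply: stabP; rewrite right_actM -xh right_actK.
  by move/PM/(_ Ph); rewrite mulgKV.
(* In the remaining case [P] fixes [x]. The swap [h] fixes [x], so it lies in [P]; its conjugates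
   have the same multiplier, hence fix [x] too. So [h] fixes all of [S], and [D a = D b]. *)
have [h [ha hb]] := transitive2 ab ba.
have Ph : P h.
  apply: stabP; have xha : to x h \in D b by rewrite -ha act_mem.
  have xhb : to x h \in D a by rewrite -hb act_mem.
  exact: meet_uniq ab xhb xha xa xb.
have [[_ tr] _] := primS.
have fix_h y : to y h = y.
  have [g1 <-] := tr x y; have [m e hm] := Ph.
  have [n n0 gn] := exists_multiplier g1.
  have : P (g1 * h * g1^-1)%g.
    exists m => //; have := multiplierM (multiplierM gn hm) (multiplierV n0 gn).
    by rewrite mulrAC mulfV // mul1r.
  move/stab; rewrite !right_actM => /(congr1 (fun y => to y g1)).
  by rewrite right_actVK.
case/eqP: ab; rewrite -ha; apply: inj_D; apply/setP => y.
by rewrite -[in RHS](fix_h y) act_mem.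
Qed.

(** Double transitivity and multipliers 1 or -1 leave only the values [alpha] and [- alpha] on the
    supports. If these differ, [cover_opp] makes [r] a tournament, which multiplier 1 preserves and
    multiplier -1 reverses. *)
Lemma cover_char2 : 2%N \in [pchar F].
Proof.
rewrite inE /=; apply: contraT => two_neq0.
have /card_gt0P[a _] : (0 < #|J|)%N by apply: leq_ltn_trans J_gt3.
have [b [ba _ _]] := avoid3 J_gt3 a a a; have ab : a != b by rewrite eq_sym.
have [x0 [xa xb]] := point ab; pose alpha := u a x0.
have alpha0 : alpha != 0 := supp_neq0 xa.
pose r k l := [exists x, [&& x \in D k, x \in D l & u k x == alpha]].
have rE k l x : k != l -> x \in D k -> x \in D l -> r k l = (u k x == alpha).
  move=> kl xk xl; apply/existsP/idP => [[y /and3P[yk yl]] | ux].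
    by rewrite (meet_uniq kl yk yl xk xl).
  by exists x; rewrite xk xl.
have sign k l x : k != l -> x \in D k -> x \in D l ->
    u k x = alpha \/ u k x = - alpha.
  move=> kl xk xl; have [g [ga gb]] := transitive2 ab kl.
  have [m /eqP m2 gm] := multiplier_sqr1 g; have := gm a x0.
  have -> : to x0 g = x.
    have xgk : to x0 g \in D k by rewrite -ga act_mem.
    have xgl : to x0 g \in D l by rewrite -gb act_mem.
    exact: meet_uniq kl xgk xgl xk xl.
  rewrite /act ga -/alpha => ->; move: m2; rewrite sqrf_eq1 => /orP[] /eqP->.
    by left; rewrite mul1r.
  by right; rewrite mulN1r opprK.
have opp_neq : (- alpha == alpha) = false.
  rewrite -subr_eq0 -opprD oppr_eq0 -mulr2n -mulr_natl mulf_eq0.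
  by rewrite (negPf two_neq0) (negPf alpha0).
case: (@no_reversible_tournament _ _ _ _ D primS J_gt3 cover_supp_translate
         cover_supp_meet cover_supp_two r).
  move=> k l kl; have [x [xk xl]] := point kl; have lk : l != k by rewrite eq_sym.
  rewrite (rE k l x) // (rE l k x) //.
  rewrite (cover_opp cov lk (supp_neq0 xl) (supp_neq0 xk)).
  by have [->|->] := sign k l x kl xk xl; rewrite ?opprK ?opp_neq eqxx.
move=> g; have [m /eqP m2 gm] := multiplier_sqr1 g.
have nact k l : k != l -> act k g != act l g.
  by rewrite (inj_eq (can_inj (actK g))).
move: m2; rewrite sqrf_eq1 => /orP[] /eqP m1; [left | right] => k l kl;
  have [x [xk xl]] := point kl;
  rewrite (rE _ _ (to x g) (nact k l kl)) -/act ?act_mem //.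
  by rewrite (rE k l x) // (gm k x) m1 mul1r.
have lk : l != k by rewrite eq_sym.
rewrite (rE l k x) // (cover_opp cov lk (supp_neq0 xl) (supp_neq0 xk)).
by rewrite (gm k x) m1 mulN1r opprK.
Qed.

(** In characteristic 2 all multipliers are 1, since [(m - 1) ^+ 2 = 0]. Elements that fix [k] and
    move [l] to [l'] carry any point of [D k] to any other, so [u k] is constant on [D k]. *)
Lemma cover_constant : exists c : F, v = c *: \sum_(x in supp v) pt F x.
Proof.
have [k [a [a0 eq_v]]] := cover_translate cov 1%g.
have t1 : translate to v 1%g = v.
  by apply/ffunP => x; rewrite translateE invg1 right_act1.
rewrite t1 in eq_v; have defD : supp v = D k by rewrite eq_v supp_scale.
have const x y : x \in D k -> y \in D k -> v x = v y.
  move=> xk yk; have [l kl xl] := other_member xk; have [l' kl' yl'] := other_member yk.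
  have [g [gk gl]] := transitive2 kl kl'; have [m m2 gm] := multiplier_sqr1 g.
  have m1 : m = 1.
    apply/eqP; rewrite -subr_eq0 -sqrf_eq0 (sqrrB1 m) m2.
    have two0 : 2%:R = 0 :> F by have := cover_char2; rewrite inE /= => /eqP.
    by rewrite -mulr_natl two0 mul0r subr0 -mulr2n two0.
  rewrite eq_v !ffunE (gm k x) m1 mul1r /act gk.
  suffices -> : to x g = y by [].
  have xgk : to x g \in D k by rewrite -gk act_mem.
  have xgl : to x g \in D l' by rewrite -gl act_mem.
  exact: meet_uniq kl' xgk xgl yk yl'.
have eval (y : S) : (\sum_(x in supp v) pt F x) y = if y \in supp v then 1 else 0.
  rewrite sum_ffunE big_mkcond (bigD1 y) //= big1 ?addr0 => [|x xy].
    by rewrite ffunE eqxx; case: ifP.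
  by rewrite ffunE eq_sym (negPf xy); case: ifP.
have [x0 x0k] : exists x, x \in D k.
  have [l [lk _ _]] := avoid3 J_gt3 k k k; have kl : k != l by rewrite eq_sym.
  by have [x [xk _]] := point kl; exists x.
exists (v x0); apply/ffunP => y; rewrite ffunE eval.
have [yv | yv] := boolP (y \in supp v); last first.
  by rewrite [RHS]mulr0; move: yv; rewrite inE negbK => /eqP.
by rewrite [RHS]mulr1; apply: const => //; rewrite -defD.
Qed.

End Signs.

(** * The incidence count of the double cover, and the conclusion *)

Lemma double_cover_count (G : groupType) (S : finType) (to : right_action G S)
    (F : fieldType) (v : permmod F S) (J : finType) (u : J -> permmod F S) :
  double_cover to v u -> (#|J| * #|supp v| = 2 * #|S|)%N.
Proof.
move=> cov; have card_u k : #|supp (u k)| = #|supp v|.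
  have [g [a [a0 eq_g]]] := cover_member cov k.
  by rewrite -(supp_scale (u k) a0) -eq_g card_supp_translate.
have two x : #|[set k | x \in supp (u k)]| = 2%N.
  have [k [l [kl xP]]] := cover_supp_two cov x.
  have -> : [set m | x \in supp (u m)] = [set k; l].
    by apply/setP => m; rewrite !inE -xP inE.
  by rewrite cards2 kl.
(* Both sides count the pairs of an index [k] and a point of [supp (u k)]; each point lies in two
   supports. *)
transitivity (\sum_k #|supp (u k)|)%N.
  by rewrite (eq_bigr (fun=> #|supp v|)) ?sum_nat_const.
transitivity (\sum_(x : S) #|[set k | x \in supp (u k)]|)%N.
  rewrite (eq_bigr (fun k => \sum_(x : S) nat_of_bool (x \in supp (u k)))); last first.
    by move=> k _; rewrite -sum1_card [LHS]big_mkcond.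
  rewrite exchange_big; apply: eq_bigr => x _.
  by rewrite -sum1dep_card [RHS]big_mkcond.
by rewrite (eq_bigr (fun=> 2%N)) ?sum_nat_const 1?mulnC.
Qed.

Theorem theoremD (G : groupType) (S : finType) (to : right_action G S)
    (F : fieldType) (v : permmod F S) :
  primitive_gset to ->
  let t := #|supp v| in
  let d := \dim (submodule_gen to v) in
  let n := #|S| in
  let Omega := orbit_of (set_right_action to) (supp v) in
  (1 < t < n - 1)%N ->
  ((t + 1) * d = 2 * n)%N ->
  [/\ t = d /\ doubly_transitive_on (set_right_action to) Omega,
      (forall x : S, #|[set D in Omega | x \in D]| = 2%N) /\
      (forall D1 D2, D1 \in Omega -> D2 \in Omega -> D1 != D2 ->
         exists x : S, D1 :&: D2 = [set x])
    & 2%N \in [pchar F] /\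
      exists c : F, v = c *: \sum_(x in supp v) pt F x].
Proof.
move=> primS t d n Omega /andP[t_gt1 t_lt] extremal.
have t_ltn : (t < n)%N by apply: leq_trans t_lt (leq_subr _ _).
(* Since [t + 1 < n], a [d] of at most 2 would give [(t + 1) * d < 2 * n]. *)
have d_gt2 : (2 < d)%N by move: extremal t_gt1 t_lt; case: (d) => [|[|[|]]]; lia.
have [u cov] := exists_double_cover primS t_gt1 t_ltn extremal d_gt2
  (exists_spanning_translates to v).
set J := option _ in u cov.
have J_gt3 : (3 < #|{: J}|)%N by rewrite card_option card_ord.
have two := cover_supp_two cov; have meet := cover_supp_meet cov.
have move_supp := cover_supp_translate cov; have inj := D_inj J_gt3 meet two.
have OmegaP D : reflect (exists k, D = supp (u k)) (D \in Omega).
  rewrite inE; apply: (iffP (asboolP _)) => [[g ->] | [k ->]].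
    have [k [a [a0 eq_g]]] := cover_translate cov g; exists k.
    by rewrite -(supp_scale (u k) a0) -eq_g supp_translate.
  have [g [a [a0 eq_g]]] := cover_member cov k; exists g.
  by rewrite -(supp_scale (u k) a0) -eq_g supp_translate.
split; last by split; [apply: cover_char2 cov | apply: cover_constant cov].
- split.
    (* The cover has [d + 1] members, so [(d + 1) * t = 2 * n = (t + 1) * d]. *)
    have := double_cover_count cov; rewrite card_option card_ord -/t -extremal -/d.
    by rewrite mulSn mulnDl mul1n [(d * t)%N]mulnC addnC => /addnI.
  split.
    pose i0 : 'I_d := Ordinal (ltnW (ltnW d_gt2)).
    apply/card_gt1P; exists (supp (u None)), (supp (u (Some i0))).
    by split; [apply/OmegaP; exists None | apply/OmegaP; eexists | rewrite (inj_eq inj)].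
  move=> _ _ _ _ /OmegaP[a ->] /OmegaP[b ->] /OmegaP[c ->] /OmegaP[e ->].
  rewrite !(inj_eq inj) => ab ce.
  have [g [ga gb]] := pair_transitive primS J_gt3 move_supp meet two ab ce.
  by exists g; rewrite -ga -gb !(idx_actE move_supp).
- split=> [x | _ _ /OmegaP[k ->] /OmegaP[l ->]]; last by rewrite (inj_eq inj) => /meet.
  have [k [l [kl xP]]] := two x.
  have -> : [set D in Omega | x \in D] = [set supp (u k); supp (u l)].
    apply/setP => D; rewrite in_set; apply/andP/set2P.
      by case=> /OmegaP[m ->]; rewrite xP => /orP[]/eqP->; [left | right].
    by case=> ->; rewrite xP eqxx ?orbT; split=> //; apply/OmegaP; eexists.
  by rewrite cards2 (inj_eq inj) kl.
Qed.
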